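(* The vertex sets of all regular polytopes are subsoluble, except for possibly the 120-cell and the 600-cell. In particular: (a) The following regular polytopes have soluble symmetry groups: in 2 dimensions, all regular polygons; in 3 dimensions, the tetrahedron, the cube and the octahedron; in 4 dimensions, the 8-cell (4-cube), the 16-cell (4-orthoplex) and the 24-cell. (b) There is a transitive soluble group action on the vertex set of each of the following regular polytopes: in 3 dimensions, the icosahedron; in 4 dimensions, the 5-cell (regular 4-simplex); in every dimension $d\ge 5$, the regular $d$-simplex, the $d$-cube and the $d$-orthoplex. (c) There is a soluble set $Y$ containing a copy of the vertex set of the dodecahedron.
   Context: Group actions on a finite set $X\subset\mathbb{R}^d$ are by isometries, i.e. every group element acts as a distance-preserving bijection of $X$. A finite set $X\subset\mathbb{R}^d$ is called soluble if there is a soluble (solvable) group that acts transitively on $X$. A finite set $X\subset\mathbb{R}^d$ is called subsoluble if there is a soluble set $Y\subset\mathbb{R}^{n}$, for some $n$ (possibly larger than $d$), containing an isometric copy of $X$. ''Copy'' means isometric copy. Regular polytopes are the convex regular polytopes in dimension at least 2: regular polygons; the five Platonic solids; the six convex regular 4-polytopes (5-cell, 8-cell, 16-cell, 24-cell, 120-cell with Schläfli symbol $\{5,3,3\}$, 600-cell with Schläfli symbol $\{3,3,5\}$); and, in each dimension $d\ge 5$, the regular $d$-simplex, the $d$-cube and the $d$-orthoplex (cross-polytope). The symmetry group of a $d$-dimensional regular polytope is the full group (including reflections) of isometries of $\mathbb{R}^d$ mapping the polytope to itself. *)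

(* Defs.v *)
From HB Require Import structures.
From mathcomp Require Import all_boot all_order all_algebra.
From mathcomp Require Import all_fingroup all_solvable finmap.
From mathcomp Require Import all_classical all_reals all_analysis.

Set Implicit Arguments.
Unset Strict Implicit.
Unset Printing Implicit Defensive.

Import Order.TTheory GRing.Theory Num.Theory.

Local Open Scope classical_set_scope.
Local Open Scope fset_scope.
Local Open Scope ring_scope.

(* MathComp's [solvable] only applies to finite groups; [soluble_group] is its
   extension to an arbitrary [groupType] (see [soluble_group_fin]), needed for
   groups of isometries of R^d and for acting groups of unrestricted size. *)
Section Soluble.
Local Open Scope group_scope.

Inductive gen_by (G : groupType) (A : set G) : set G :=
| gen_by_sub x : A x -> gen_by A x
| gen_by1 : gen_by A 1
| gen_byM x y : gen_by A x -> gen_by A y -> gen_by A (x * y)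
| gen_byV x : gen_by A x -> gen_by A x^-1.

Fixpoint derived_series {G : groupType} (n : nat) : set G :=
  if n is n'.+1 then
    gen_by [set z | exists x y, derived_series n' x /\
                                   derived_series n' y /\ z = [~ x, y]]%classic
  else [set: G]%classic.

Definition soluble_group (G : groupType) : Prop :=
  exists n, (@derived_series G n `<=` [set 1])%classic.

Lemma derived_series_fin (gT : finGroupType) n (x : gT) :
  derived_series n x <-> x \in [set: gT]%SET^`(n).
Proof.
elim: n x => [|n IHn] x; first by rewrite derg0 inE.
rewrite dergSn; split.
  move=> /=; elim=> {x} [x [y [z [Dy [Dz ->]]]]||x y _ Dx _ Dy|x _ Dx].
  - by rewrite mem_commg //; apply/IHn.
  - exact: group1.
  - exact: groupM.
  - exact: groupVr.
pose A := [set u : gT | `[< derived_series n.+1 u >]]%SET.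
have gA : group_set A.
  apply/group_setP; split; first by rewrite inE; apply/asboolP/gen_by1.
  move=> u v; rewrite !inE; exact: gen_byM.
suff /fintype.subsetP sDA : [set: gT]%SET^`(n.+1) \subset Group gA.
  by rewrite -dergSn => /sDA; rewrite !inE.
rewrite dergSn gen_subG.
apply/fintype.subsetP => _ /imset2P[y z Dy Dz ->]; rewrite !inE.
by apply: gen_by_sub; exists y, z; split; [|split] => //; apply/IHn.
Qed.

Lemma soluble_group_fin (gT : finGroupType) :
  soluble_group gT <-> solvable [set: gT]%SET.
Proof.
split=> [[n Dn]|/derivedP[n Dn]].
  apply/derivedP; exists n; apply/trivgP/fintype.subsetP => x /derived_series_fin/Dn ->.
  exact: group1.
by exists n => x /derived_series_fin; rewrite Dn => /set1P.
Qed.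

End Soluble.

Section Euclidean.
Variable R : realType.

(* The norm that the library puts on row vectors is the sup norm. *)
Definition eucl_dist d (x y : 'rV[R]_d) : R :=
  Num.sqrt (\sum_(i < d) (x 0 i - y 0 i) ^+ 2).

Definition scaled_copy (c : R) m n (V : {fset 'rV[R]_m})
    (X : {fset 'rV[R]_n}) : Prop :=
  exists f : 'rV[R]_m -> 'rV[R]_n,
    {in V &, forall x y, eucl_dist (f x) (f y) = c * eucl_dist x y} /\
    X = [fset f x | x in V].

Definition isometric_copy m n (V : {fset 'rV[R]_m}) (X : {fset 'rV[R]_n}) :=
  scaled_copy 1 V X.

Definition similar_copy m n (V : {fset 'rV[R]_m}) (X : {fset 'rV[R]_n}) : Prop :=
  exists2 c : R, 0 < c & scaled_copy c V X.

Definition soluble_set d (X : {fset 'rV[R]_d}) : Prop :=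
  exists (G : groupType) (act : G -> X -> X),
    [/\ soluble_group G,
        (forall x, act 1%g x = x) /\
        (forall g h x, act (g * h)%g x = act g (act h x)),
        forall g x y, eucl_dist (val (act g x)) (val (act g y)) =
                      eucl_dist (val x) (val y)
      & forall x y, exists g, act g x = y].

Definition subsoluble d (X : {fset 'rV[R]_d}) : Prop :=
  exists n (Y : {fset 'rV[R]_n}), soluble_set Y /\
    exists2 X' : {fset 'rV[R]_n}, isometric_copy X X' & X' `<=` Y.

Definition convex_hull d (X : {fset 'rV[R]_d}) : set 'rV[R]_d :=
  [set y | exists w : X -> R,
     [/\ forall x, 0 <= w x, \sum_x w x = 1 & y = \sum_x w x *: val x]].

End Euclidean.

Section Symmetry.
Variables (R : realType) (d : nat).

Definition is_symmetry (P : set 'rV[R]_d) (f : 'rV[R]_d -> 'rV[R]_d) : Prop :=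
  [/\ forall x y, eucl_dist (f x) (f y) = eucl_dist x y,
      bijective f
    & (f @` P = P)%classic].

Definition symmetries (P : set 'rV[R]_d) : Type := {f | is_symmetry P f}.

Variable P : set 'rV[R]_d.

Lemma symmetry_inj (f g : symmetries P) : sval f =1 sval g -> f = g.
Proof.
case: f g => [f Sf] [g Sg] /= /funext fg; subst g.
by congr exist; exact: Prop_irrelevance.
Qed.

Lemma is_symmetry_id : is_symmetry P id.
Proof. by split=> //; [exists id|rewrite image_id]. Qed.

Lemma is_symmetry_comp f g :
  is_symmetry P f -> is_symmetry P g -> is_symmetry P (f \o g).
Proof.
move=> [If Bf Pf] [Ig Bg Pg]; split; last by rewrite -image_comp Pg.
- by move=> x y /=; rewrite If Ig.
- exact: bij_comp.
Qed.

Lemma symmetry_inv_ex (f : symmetries P) :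
  exists g : symmetries P, cancel (sval f) (sval g).
Proof.
case: f => f /= [If [g fK gK] Pf].
have Sg : is_symmetry P g.
  split; first by move=> x y; rewrite -[in RHS](gK x) -[in RHS](gK y) If.
  - by exists f.
  - rewrite -[in LHS]Pf image_comp.
    by rewrite (_ : g \o f = id) ?image_id //; apply/funext => x /=; rewrite fK.
by exists (exist _ g Sg).
Qed.

Definition symmetry_one : symmetries P := exist _ id is_symmetry_id.
Definition symmetry_mul (f g : symmetries P) : symmetries P :=
  exist _ (sval f \o sval g) (is_symmetry_comp (svalP f) (svalP g)).
Definition symmetry_inv (f : symmetries P) : symmetries P :=
  sval (cid (symmetry_inv_ex f)).

Lemma symmetry_mulA : associative symmetry_mul.
Proof. by move=> f g h; exact: symmetry_inj. Qed.
Lemma symmetry_mul1 : left_id symmetry_one symmetry_mul.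
Proof. by move=> f; exact: symmetry_inj. Qed.
Lemma symmetry_mulr1 : right_id symmetry_one symmetry_mul.
Proof. by move=> f; exact: symmetry_inj. Qed.
Lemma symmetry_mulV : left_inverse symmetry_one symmetry_inv symmetry_mul.
Proof.
move=> f; apply: symmetry_inj => x /=.
by rewrite /symmetry_inv; case: cid => g /= ->.
Qed.
Lemma symmetry_mulrV : right_inverse symmetry_one symmetry_inv symmetry_mul.
Proof.
move=> f; apply: symmetry_inj => x /=; rewrite /symmetry_inv; case: cid => g /= fK.
have [_ [f' f'K fK'] _] := svalP f.
by rewrite -[in LHS](fK' x) fK fK'.
Qed.

HB.instance Definition _ := gen_eqMixin (symmetries P).
HB.instance Definition _ := gen_choiceMixin (symmetries P).
HB.instance Definition _ := isGroup.Build (symmetries P)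
  symmetry_mulA symmetry_mul1 symmetry_mulr1 symmetry_mulV symmetry_mulrV.

End Symmetry.

Definition symmetry_group (R : realType) d (X : {fset 'rV[R]_d}) : groupType :=
  symmetries (convex_hull X).

Section RegularPolytopes.
Variable R : realType.

Definition coords d (s : seq R) : 'rV[R]_d := \row_(i < d) s`_i.

(* All points obtained from [v] by permuting its coordinates by an element
   of [S] and then changing the signs of some coordinates. *)
Definition signed_perms d (S : {set 'S_d}) (v : 'rV[R]_d) : {fset 'rV[R]_d} :=
  [fset \row_i ((-1) ^+ (i \in E) * v 0 (s i)) |
     E : {set 'I_d} in [set: {set 'I_d}]%SET, s : 'S_d in S].

Definition all_perms d : {set 'S_d} := [set: 'S_d]%SET.
Definition even_perms d : {set 'S_d} := [set s : 'S_d | ~~ odd_perm s]%SET.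

Definition golden : R := (1 + Num.sqrt 5) / 2.

Definition polygon n : {fset 'rV[R]_2} :=
  [fset coords 2 [:: cos (2 * pi * k%:R / n%:R); sin (2 * pi * k%:R / n%:R)] |
     k : 'I_n in 'I_n].

Definition hypercube d : {fset 'rV[R]_d} := signed_perms (all_perms d) (const_mx 1).

Definition orthoplex d : {fset 'rV[R]_d} :=
  [fset delta_mx 0 i | i : 'I_d in 'I_d] `|` [fset - delta_mx 0 i | i : 'I_d in 'I_d].

Definition dodecahedron : {fset 'rV[R]_3} :=
  signed_perms (all_perms 3) (coords 3 [:: 1; 1; 1]) `|`
  signed_perms (even_perms 3) (coords 3 [:: 0; golden^-1; golden]).

Definition icosahedron : {fset 'rV[R]_3} :=
  signed_perms (even_perms 3) (coords 3 [:: 0; 1; golden]).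

Definition cell24 : {fset 'rV[R]_4} :=
  signed_perms (all_perms 4) (coords 4 [:: 1; 1; 0; 0]).

(* Standard coordinates: circumradius [sqrt 8] for the 120-cell (600 vertices),
   and [2] for the 600-cell (120 vertices). *)
Definition cell120 : {fset 'rV[R]_4} :=
  signed_perms (all_perms 4) (coords 4 [:: 0; 0; 2; 2]) `|`
  signed_perms (all_perms 4) (coords 4 [:: 1; 1; 1; Num.sqrt 5]) `|`
  signed_perms (all_perms 4) (coords 4 [:: golden ^- 2; golden; golden; golden]) `|`
  signed_perms (all_perms 4)
    (coords 4 [:: golden^-1; golden^-1; golden^-1; golden ^+ 2]) `|`
  signed_perms (even_perms 4) (coords 4 [:: 0; golden ^- 2; 1; golden ^+ 2]) `|`
  signed_perms (even_perms 4) (coords 4 [:: 0; golden^-1; golden; Num.sqrt 5]) `|`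
  signed_perms (even_perms 4) (coords 4 [:: golden^-1; 1; golden; 2]).

Definition cell600 : {fset 'rV[R]_4} :=
  signed_perms (all_perms 4) (coords 4 [:: 2; 0; 0; 0]) `|`
  signed_perms (all_perms 4) (coords 4 [:: 1; 1; 1; 1]) `|`
  signed_perms (even_perms 4) (coords 4 [:: golden; 1; golden^-1; 0]).

Definition regular_simplex d (X : {fset 'rV[R]_d}) : Prop :=
  #|` X| = d.+1 /\
  exists2 a : R, 0 < a & {in X &, forall x y, x != y -> eucl_dist x y = a}.

(* [regular_polytope X]: [X] is the vertex set of a convex regular polytope of
   dimension [d] in R^d, of any size and in any position. For [d] = 3 and 4 the
   three infinite families give the tetrahedron, cube and octahedron, and the
   5-cell, 8-cell and 16-cell. *)
Inductive regular_polytope : forall d, {fset 'rV[R]_d} -> Prop :=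
| regular_polytope_polygon n (X : {fset 'rV[R]_2}) :
    (3 <= n)%N -> similar_copy (polygon n) X -> regular_polytope X
| regular_polytope_simplex d (X : {fset 'rV[R]_d}) :
    (3 <= d)%N -> regular_simplex X -> regular_polytope X
| regular_polytope_cube d (X : {fset 'rV[R]_d}) :
    (3 <= d)%N -> similar_copy (hypercube d) X -> regular_polytope X
| regular_polytope_orthoplex d (X : {fset 'rV[R]_d}) :
    (3 <= d)%N -> similar_copy (orthoplex d) X -> regular_polytope X
| regular_polytope_dodecahedron (X : {fset 'rV[R]_3}) :
    similar_copy dodecahedron X -> regular_polytope X
| regular_polytope_icosahedron (X : {fset 'rV[R]_3}) :
    similar_copy icosahedron X -> regular_polytope X
| regular_polytope_cell24 (X : {fset 'rV[R]_4}) :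
    similar_copy cell24 X -> regular_polytope X
| regular_polytope_cell120 (X : {fset 'rV[R]_4}) :
    similar_copy cell120 X -> regular_polytope X
| regular_polytope_cell600 (X : {fset 'rV[R]_4}) :
    similar_copy cell600 X -> regular_polytope X.

End RegularPolytopes.

(* Main.v *)
(* To see that a set is soluble it suffices to parametrise it by a soluble group so that
   the induced pseudometric is left-invariant; signed permutation groups over soluble
   permutation groups and cyclic groups do this for every polytope of (a) and (b).

   A symmetry of a transitive polytope fixes the centroid and permutes the points of the
   hull farthest from it, which are the vertices; it is determined by its action on them.
   So the symmetry group embeds in the group of isometric permutations of the vertices.
   For a polygon these are affine maps of Z/n.  Otherwise the vertices carry a chain of
   equivalence relations defined by distances, each class splitting into at most four
   classes of the next relation: the exponent then divides a power of 12 and Burnside's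
   p^a q^b theorem applies.

   For the dodecahedron let rho be a rotation of order 5.  The pyritohedral group T has two
   orbits on the vertices, an inscribed cube and the other 12 vertices, and exactly two of
   x, rho x, .., rho^4 x lie on the cube.  As AGL(1,5) is soluble and 2-transitive on the
   five positions, x |-> (rho^k x)_k / sqrt 5 maps the dodecahedron isometrically into one
   orbit of the wreath product of T with AGL(1,5). *)

Require Import Defs.
From HB Require Import structures.
From mathcomp Require Import all_boot all_order all_algebra.
From mathcomp Require Import all_fingroup all_solvable integral_char finmap.
From mathcomp Require Import all_classical all_reals all_analysis.
From mathcomp Require Import ring lra.

Set Implicit Arguments.
Unset Strict Implicit.
Unset Printing Implicit Defensive.

Import Order.TTheory GRing.Theory Num.Theory.

(** * Soluble groups *)

Section SolubleGroups.
Local Open Scope group_scope.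

Lemma gen_by_elim (G : groupType) (A P : set G) :
  P 1 -> (forall x y, P x -> P y -> P (x * y)) -> (forall x, P x -> P x^-1) ->
  (forall x, A x -> P x) -> forall x, gen_by A x -> P x.
Proof.
by move=> P1 PM PV AP x; elim=> [y Ay||y z _ Py _ Pz|y _ Py] //; [apply: AP|apply: PM|apply: PV].
Qed.

Lemma derived_series_closed (G : groupType) k :
  [/\ derived_series k (1 : G),
      forall x y : G, derived_series k x -> derived_series k y ->
        derived_series k (x * y)
    & forall x : G, derived_series k x -> derived_series k x^-1].
Proof.
by case: k => [|k]; split=> // *; [apply: gen_by1|apply: gen_byM|apply: gen_byV].
Qed.

Lemma derived_series_sub (G : groupType) k m (x : G) :
  derived_series (m + k) x -> derived_series k x.
Proof.
have [D1 DM DV] := derived_series_closed G k.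
elim: m x => // m IHm x.
apply: (gen_by_elim (P := @derived_series G k)) => //= _ [y [z [/IHm Dy [/IHm Dz ->]]]].
rewrite /commg /conjg.
by apply: (DM); [exact: (DV)|apply: (DM); [exact: (DV)|exact: (DM)]].
Qed.

(** Multiplicativity is demanded only on the [k]-th derived subgroup: a coordinate projection of a
    wreath product is a morphism only where the permutation part is trivial. *)
Lemma derived_series_morph (G K : groupType) (phi : G -> K) k :
  (forall x y, derived_series k x -> derived_series k y ->
     phi (x * y) = phi x * phi y) ->
  forall m x, derived_series (m + k) x -> derived_series m (phi x).
Proof.
move=> phiM; have [D1 DM DV] := derived_series_closed G k.
have phi1 : phi 1 = 1 by apply: (mulgI (phi 1)); rewrite -phiM // !mulg1.
have phiV x : derived_series k x -> phi x^-1 = (phi x)^-1.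
  by move=> Dx; apply: (mulgI (phi x)); rewrite -phiM ?mulgV //; apply: (DV).
elim=> [//|m IHm] x Dx.
(* Membership in the [k]-th term is carried through the induction so that [phiM] applies to each
   product and inverse. *)
suff [] : derived_series k x /\ derived_series m.+1 (phi x) by [].
move: x Dx; apply: gen_by_elim => [|x y [Dx Px] [Dy Py]|x [Dx Px]|].
- by split=> //; rewrite phi1; apply: gen_by1.
- by split; [exact: (DM)|rewrite phiM //; apply: gen_byM].
- by split; [exact: (DV)|rewrite phiV //; apply: gen_byV].
move=> x Dx; split.
  by apply: (@derived_series_sub _ _ m.+1); apply: gen_by_sub.
case: Dx => y [z [Dy [Dz ->]]].
have [Ey Ez] := (derived_series_sub Dy, derived_series_sub Dz).
apply: gen_by_sub; exists (phi y), (phi z).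
do 2?[split; first exact: IHm].
rewrite /commg /conjg !phiM ?phiV //.
- exact: (DV).
- exact: (DM).
- exact: (DV).
- by apply: (DM); [exact: (DV)|exact: (DM)].
Qed.

Lemma soluble_group_embed (G K : groupType) (phi : G -> K) :
  {morph phi : x y / x * y} -> (forall x, phi x = 1 -> x = 1) ->
  soluble_group K -> soluble_group G.
Proof.
move=> phiM phi_inj [n Kn]; exists n => x Dx; apply: phi_inj; apply: Kn.
by apply: (@derived_series_morph _ _ _ 0); [move=> *; apply: phiM|rewrite addn0].
Qed.

Lemma soluble_group_abelian (G : groupType) :
  (forall x y : G, x * y = y * x) -> soluble_group G.
Proof.
move=> comm; exists 1%N.
apply: (gen_by_elim (P := [set 1]%classic)) => [|x y -> ->|x ->|_ [y [z [_ [_ ->]]]]].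
- by [].
- by rewrite mulg1.
- by rewrite invg1.
- by rewrite /commg /conjg (comm y z) mulKg mulVg.
Qed.

Lemma soluble_subg (gT : finGroupType) (H : {group gT}) :
  solvable H -> soluble_group (subg_of H).
Proof. by move=> solH; apply/soluble_group_fin; rewrite -(isog_sol (isog_subg H)). Qed.

Lemma solvable_two_primes (gT : finGroupType) (G : {group gT}) :
  (forall p, prime p -> p %| #|G| -> p \in [:: 2; 3])%N -> solvable G.
Proof.
move=> pG; apply: Burnside_p_a_q_b.
apply: (@uniq_leq_size _ _ [:: 2; 3]%N (primes_uniq _)) => p.
by rewrite mem_primes => /and3P[pr_p _ /pG]; apply.
Qed.

(** By Cauchy's theorem a prime dividing the order is the order of an element, hence divides
    [12 ^ n]. *)
Lemma solvable_exponent12 (gT : finGroupType) (G : {group gT}) n :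
  {in G, forall x, x ^+ (12 ^ n) = 1} -> solvable G.
Proof.
move=> expG; apply: solvable_two_primes => p pr_p /(Cauchy pr_p)[x Gx ox].
have: p %| 12 ^ n by rewrite -ox order_dvdn expG.
rewrite Euclid_dvdX // => /andP[]; rewrite (_ : 12 = 2 * (2 * 3))%N // !Euclid_dvdM //.
by rewrite !(dvdn_prime2 pr_p) // !inE => /or3P[]/eqP->.
Qed.

Lemma solvable_small_degree (T : finType) (H : {group {perm T}}) :
  (#|T| <= 4)%N -> solvable H.
Proof.
move=> T4; apply: solvable_two_primes => p pr_p pH.
have : (p %| 4`!)%N.
  apply: dvdn_trans pH _; apply: (@dvdn_trans (#|T|)`!); last first.
    by rewrite -(bin_fact T4) dvdn_mull // dvdn_mulr.
  have <- : #|[set: {perm T}]| = (#|T|)`!.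
    rewrite -cardsT -card_perm; apply: eq_card => s; rewrite inE unfold_in.
    by apply/esym/fintype.subsetP.
  by rewrite cardSg ?finset.subsetT.
rewrite (_ : 4`! = 2 * (2 * (2 * 3)))%N // !Euclid_dvdM // !(dvdn_prime2 pr_p) //.
by rewrite !inE => /or4P[]/eqP->.
Qed.

(* The commutator of two affine maps is a translation, and translations commute. *)
Lemma solvable_affine (T : finType) (A : comPzRingType) (lab : T -> A)
    (H : {group {perm T}}) :
  injective lab ->
  (forall s, s \in H -> exists a b, forall x, lab (s x) = a * lab x + b)%R ->
  solvable H.
Proof.
move=> lab_inj affH.
have transl s : s \in H^`(1) -> exists b, forall x, lab (s x) = (lab x + b)%R.
  case/gen_prodgP => n [c Hc ->].
  elim: n c Hc => [|n IHn] c Hc.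
    by exists 0%R => x; rewrite big_ord0 perm1 addr0.
  rewrite big_ord_recr /=; have [|b Eb] := IHn (fun i => c (widen_ord (leqnSn n) i)).
    by move=> i; apply: Hc.
  suff [b' Eb'] : exists b', forall x, lab (c ord_max x) = (lab x + b')%R.
    by exists (b + b')%R => x; rewrite permM Eb' Eb addrA.
  have /imset2P[u t Hu Ht ->] := Hc ord_max.
  have [a [e sE]] := affH u Hu; have [a' [e' tE]] := affH t Ht.
  (* [[~ u, t]] sends [u (t y)] to [t (u y)]. The linear parts agree because the ring is
     commutative, and the witness is the difference of the constant terms. *)
  exists (a' * e + e' - (a * e' + e))%R => x.
  have -> : x = (t * u)%g ((t * u)^-1%g x) by rewrite permKV.
  move: ((t * u)^-1%g x) => y; rewrite -permM.
  have -> : (t * u * [~ u, t] = u * t)%g by rewrite -commgC.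
  by rewrite !permM tE sE sE tE; ring.
apply/derivedP; exists 2; rewrite dergSn; apply/commG1P.
apply/fintype.subsetP => s /transl[b Eb]; apply/centP => t /transl[b' Eb'].
by apply/permP => x; apply: lab_inj; rewrite !permM Eb Eb' Eb Eb' addrAC.
Qed.

End SolubleGroups.

(** * Groups preserving a chain of equivalence relations defined by distances *)

Section MetricTrees.
Local Open Scope group_scope.

(** An exhaustive search that picks a first element and continues among its neighbours. The value at
    0 is [false] because the empty clique always exists. *)
Fixpoint clique_free (T : Type) (r : rel T) (k : nat) (s : seq T) : bool :=
  if k is k'.+1 then all (fun x => clique_free r k' [seq y <- s | r x y]) s
  else false.

Lemma clique_freeP (T : eqType) (r : rel T) (s t : seq T) :
  clique_free r (size t) s -> {subset t <= s} -> ~~ pairwise r t.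
Proof.
elim: t s => [//|x t IHt] s /= /allP free ts.
apply/negP => /andP[/allP rx]; apply/negP; apply: (IHt _ (free x (ts x (mem_head x t)))).
by move=> y ty; rewrite mem_filter rx // ts // inE ty orbT.
Qed.

(* Among x, h x, .., h^4 x two are e-related, so h^m fixes the e-class of x for some
   m <= 4, and m divides 12. *)
Lemma exponent12_step (T : finType) (H : {group {perm T}}) (E e : rel T) n :
  transitive E -> transitive e ->
  (forall s, s \in H -> forall x y, e (s x) (s y) = e x y) ->
  (forall s, s \in H -> forall x, E x ((s ^+ n) x)) ->
  (forall t : seq T, size t = 5 ->
     ~~ pairwise (fun x y => E x y && ~~ e x y) t) ->
  forall s, s \in H -> forall x, e x ((s ^+ (12 * n)) x).
Proof.
move=> trE tre inve En free s Hs x; rewrite mulnC expgM.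
set h := s ^+ n; have Hh k : h ^+ k \in H by rewrite !groupX.
have Eh y k : E y ((h ^+ k.+1) y).
  elim: k => [|k IHk]; first by rewrite expg1; exact: En.
  by apply: trE IHk _; rewrite [h ^+ k.+2]expgSr permM; exact: En.
have iter_e k m : e x ((h ^+ k) x) -> e x ((h ^+ (k * m.+1)) x).
  move=> ek; elim: m => [|m IHm]; first by rewrite muln1.
  by apply: tre IHm _; rewrite [(k * m.+2)%N]mulnS expgD permM inve // Hh.
have key i j : (i < j < 5)%N -> e ((h ^+ i) x) ((h ^+ j) x) -> e x ((h ^+ 12) x).
  case/andP=> ij j5; rewrite -{1}(subnK (ltnW ij)) expgD permM inve // => ek.
  have : (0 < j - i < 5)%N by rewrite subn_gt0 ij (leq_ltn_trans (leq_subr _ _)).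
  case: (j - i)%N ek => [|[|[|[|[|]]]]] // /iter_e ek _.
  (* The arguments are 12 / k - 1 for k = 1, 2, 3, 4. *)
  - exact: (ek 11).
  - exact: (ek 5).
  - exact: (ek 3).
  - exact: (ek 2).
(* Otherwise x, h x, .., h^4 x would be five [E]-related points, no two of them [e]-related, which
   [free] forbids. *)
apply: contraNT (free [seq (h ^+ i) x | i <- iota 0 5] erefl) => ne.
rewrite pairwise_map; apply/(pairwiseP 0) => i j; rewrite !inE !size_iota => i5 j5 ij.
rewrite !nth_iota // !add0n /= {1}(_ : j = i + (j - i.+1).+1)%N; last by rewrite -addSnnS subnKC.
rewrite expgD permM Eh /=; apply: contra ne.
by apply: key; rewrite ij.
Qed.

(** The lists in [Ss] contain the distances allowed within a class, from coarse to fine. The test is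
    boolean so that computation settles it; excluding 5-cliques says that a class of [E] splits into
    at most four classes of the next relation. *)
Fixpoint distance_tree (U : eqType) (D : U -> U -> int) (L : seq U)
    (E : rel U) (Ss : seq (seq int)) : bool :=
  if Ss is V :: Ss' then
    let e := fun u v => D u v \in V in
    [&& all (fun u => all (fun v => e u v ==> all (fun w => e v w ==> e u w) L) L) L,
        clique_free (fun u v => E u v && ~~ e u v) 5 L & distance_tree D L e Ss']
  else true.

(** Each level multiplies by 12 an exponent whose powers keep every point in its class. The final
    list [[:: 0]] makes the last relation equality, so the exponent of [H] divides a power of 12. *)
Lemma solvable_distance_tree (T : finType) (H : {group {perm T}}) (U : eqType)
    (D : U -> U -> int) (L : seq U) (lab : T -> U) (Ss : seq (seq int)) :
  (forall x, lab x \in L) ->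
  (forall s, s \in H -> forall x y, D (lab (s x)) (lab (s y)) = D (lab x) (lab y)) ->
  (forall x y, D (lab x) (lab y) = 0%R -> x = y) ->
  distance_tree D L (fun _ _ => true) (rcons Ss [:: 0%R]) -> solvable H.
Proof.
move=> labL invD D0 tree; apply: (@solvable_exponent12 _ _ (size Ss).+1) => s Hs.
apply/permP => x; rewrite perm1; apply/esym/D0; move: s Hs x.
(* The induction on [Ss] needs an arbitrary current relation and the exponent [12 ^ n] reached so
   far; it starts from the full relation with exponent 1. *)
suff gen : forall n (E : rel U), transitive (relpre lab E) ->
    (forall s, s \in H -> forall x, E (lab x) (lab ((s ^+ (12 ^ n)) x))) ->
    distance_tree D L E (rcons Ss [:: 0%R]) ->
    forall s, s \in H -> forall x, D (lab x) (lab ((s ^+ (12 ^ (n + (size Ss).+1))) x)) = 0%R.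
  by exact: (gen 0 (fun _ _ => true)).
have step n E (V : seq int) : transitive (relpre lab E) ->
    (forall s, s \in H -> forall x, E (lab x) (lab ((s ^+ n) x))) ->
    all (fun u => all (fun v => (D u v \in V) ==> all (fun w => (D v w \in V) ==>
      (D u w \in V)) L) L) L ->
    clique_free (fun u v => E u v && (D u v \notin V)) 5 L ->
    transitive (relpre lab (fun u v => D u v \in V)) /\
    forall s, s \in H -> forall x, D (lab x) (lab ((s ^+ (12 * n)) x)) \in V.
  move=> trE En tre free.
  have tr : transitive (relpre lab (fun u v => D u v \in V)).
    move=> y x z /= xy yz; move/allP: tre => /(_ _ (labL x))/allP/(_ _ (labL y)).
    by rewrite xy => /allP/(_ _ (labL z)); rewrite yz.
  split=> // s Hs x.
  apply: (@exponent12_step _ H (relpre lab E) (relpre lab (fun u v => D u v \in V))) => //.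
    by move=> {}s {}Hs y z /=; rewrite invD.
  move=> t t5; rewrite -(pairwise_map lab (fun u v => E u v && (D u v \notin V))).
  apply: (@clique_freeP _ _ L); first by rewrite size_map t5.
  by move=> _ /mapP[y _ ->].
elim: Ss {tree} => [|V Ss IHV] n E trE En /= /and3P[tre free tree] s Hs x.
  have [_ /(_ s Hs x)] := step (12 ^ n)%N E [:: 0%R] trE En tre free.
  by rewrite addn1 expnS inE => /eqP.
have [trV nV] := step (12 ^ n)%N E V trE En tre free.
by rewrite addnS -addSn; apply: IHV tree _ Hs _ => //; rewrite expnS.
Qed.

End MetricTrees.

(** * Solubility of wreath products *)

Section Wreath.
Local Open Scope group_scope.
Variables (A : finGroupType) (I : finType) (H : {group {perm I}}).

(* MathComp permutations compose left to right, so (f, s) acts on vectors indexed by I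
   by sending x to the vector with entries f_i . x_(s i). *)
Definition wreath : Type := ({ffun I -> A} * subg_of H)%type.

HB.instance Definition _ := Finite.on wreath.

Definition wreath_one : wreath := ([ffun=> 1], 1).
Definition wreath_mul (x y : wreath) : wreath :=
  ([ffun i => x.1 i * y.1 (sgval x.2 i)], x.2 * y.2).
Definition wreath_inv (x : wreath) : wreath :=
  ([ffun i => (x.1 (sgval x.2^-1 i))^-1], x.2^-1).

Lemma wreath_mulA : associative wreath_mul.
Proof.
move=> x y z; congr pair; last exact: mulgA.
by apply/ffunP => i; rewrite !ffunE /= permM mulgA.
Qed.
Lemma wreath_mul1 : left_id wreath_one wreath_mul.
Proof.
case=> f s; congr pair; last exact: mul1g.
by apply/ffunP => i; rewrite !ffunE /= perm1 mul1g.
Qed.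
Lemma wreath_mulV : left_inverse wreath_one wreath_inv wreath_mul.
Proof.
case=> f s; congr pair; last exact: mulVg.
by apply/ffunP => i; rewrite !ffunE /= mulVg.
Qed.

HB.instance Definition _ :=
  Finite_isGroup.Build wreath wreath_mulA wreath_mul1 wreath_mulV.

(** After [n] derived steps the permutation part is trivial. There every coordinate is a morphism to
    [A], so [m] further steps make all coordinates trivial. *)
Lemma soluble_wreath : soluble_group A -> solvable H -> soluble_group wreath.
Proof.
move=> [m Am] /soluble_subg[n Hn]; exists (m + n)%N => x Dx.
have top (y : wreath) : derived_series n y -> y.2 = 1.
  move=> Dy; apply: Hn; apply: (@derived_series_morph _ _ (snd : wreath -> _) 0) => //.
  by rewrite addn0.
case: x Dx => f s Dx; have /= s1 := top _ (derived_series_sub Dx); subst s.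
congr pair; apply/ffunP => i; rewrite ffunE.
apply: Am; apply: (@derived_series_morph _ _ (fun y : wreath => y.1 i) n _ m _ Dx).
by move=> y z /top y1 _; rewrite ffunE y1 perm1.
Qed.

End Wreath.

Local Open Scope ring_scope.

(** * Soluble sets *)

Section Euclid.
Variable R : realType.

(** Squared distances are polynomial in the coordinates; [eucl_dist_scale] and [eucl_dist_eq]
    translate to and from [eucl_dist]. *)
Definition sqdist d (x y : 'rV[R]_d) : R := \sum_(i < d) (x 0 i - y 0 i) ^+ 2.

Lemma sqdist_ge0 d (x y : 'rV[R]_d) : 0 <= sqdist x y.
Proof. by apply: sumr_ge0 => i _; rewrite sqr_ge0. Qed.

Lemma sqr_eucl_dist d (x y : 'rV[R]_d) : eucl_dist x y ^+ 2 = sqdist x y.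
Proof. by rewrite sqr_sqrtr // sqdist_ge0. Qed.

Lemma eucl_dist_scale m n (c : R) (x y : 'rV[R]_m) (u v : 'rV[R]_n) :
  0 <= c -> (eucl_dist u v = c * eucl_dist x y) <-> (sqdist u v = c ^+ 2 * sqdist x y).
Proof.
move=> c0; rewrite -!sqr_eucl_dist -exprMn; split=> [->//|/eqP].
by rewrite eqrXn2 ?mulr_ge0 ?sqrtr_ge0 // => /eqP.
Qed.

Lemma eucl_dist_eq m n (x y : 'rV[R]_m) (u v : 'rV[R]_n) :
  (eucl_dist u v = eucl_dist x y) <-> (sqdist u v = sqdist x y).
Proof.
by have := @eucl_dist_scale m n 1 x y u v ler01; rewrite expr1n !mul1r.
Qed.

Lemma sqdist0 d (x y : 'rV[R]_d) : sqdist x y = 0 -> x = y.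
Proof.
move/eqP; rewrite psumr_eq0 => [/allP xy|i _]; last exact: sqr_ge0.
apply/rowP => i; apply/eqP; rewrite -subr_eq0 -sqrf_eq0.
by apply: xy; rewrite mem_index_enum.
Qed.

Lemma sqdistxx d (x : 'rV[R]_d) : sqdist x x = 0.
Proof. by apply: big1 => i _; rewrite subrr expr0n. Qed.

Lemma sqdistC d (x y : 'rV[R]_d) : sqdist x y = sqdist y x.
Proof. by apply: eq_bigr => i _; rewrite -sqrrN opprB. Qed.

(** Let [g] send [p h] to [p (g * h)]. Invariance, applied to points at distance 0, shows that the
    result depends only on [p h], so a choice of parameters [r] yields an action. *)
Lemma soluble_set_orbit d (G : groupType) (p : G -> 'rV[R]_d) (X : {fset 'rV[R]_d}) :
  soluble_group G ->
  (forall g h k, sqdist (p (g * h)%g) (p (g * k)%g) = sqdist (p h) (p k)) ->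
  (forall x, x \in X <-> exists g, x = p g) -> soluble_set X.
Proof.
move=> solG pG pX; pose r (x : X) : G := sval (cid ((pX (val x)).1 (valP x))).
have rE x : p (r x) = val x by rewrite /r; case: cid.
have pXP g : p g \in X by apply/pX; exists g.
pose act g x : X := [` pXP (g * r x)%g]%fset.
exists G, act; split=> //.
- split=> [x|g h x]; apply: val_inj; rewrite /= ?mul1g ?rE //.
  by apply: sqdist0; rewrite -mulgA pG rE /= sqdistxx.
- by move=> g x y; apply/eucl_dist_eq; rewrite /= pG !rE.
- move=> x y; exists (r y * (r x)^-1)%g; apply: val_inj => /=.
  by rewrite mulgKV rE.
Qed.

Lemma soluble_set0 d : soluble_set (fset0 : {fset 'rV[R]_d}).
Proof.
exists 'S_1, (fun _ x => x); split=> //; last by case.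
by apply: soluble_group_abelian => s t; apply/permP => i; rewrite !permM !ord1.
Qed.

Lemma soluble_set_similar m n (V : {fset 'rV[R]_m}) (X : {fset 'rV[R]_n}) :
  soluble_set V -> similar_copy V X -> soluble_set X.
Proof.
move=> [G [act [solG [act1 actM] iso trans]]] [c c0 [f [fE ->]]].
have [->|[v0 Vv0]] := fset_0Vmem V; first by rewrite imfset0; exact: soluble_set0.
pose p g := f (val (act g [` Vv0]%fset)).
apply: (@soluble_set_orbit _ G p) => // [g h k|x].
  apply/eucl_dist_eq; rewrite !fE ?(valP (act _ _)) //.
  by rewrite !actM iso.
split=> [/imfsetP[v /= Vv ->]|[g ->]].
  by have [g gE] := trans [` Vv0]%fset [` Vv]%fset; exists g; rewrite /p gE.
by apply/imfsetP; exists (val (act g [` Vv0]%fset)) => //; exact: valP.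
Qed.

Lemma soluble_subsoluble d (X : {fset 'rV[R]_d}) : soluble_set X -> subsoluble X.
Proof.
move=> solX; exists d, X; split=> //; exists X => //; exists id.
split=> [x y _ _|]; first by rewrite mul1r.
by apply/fsetP => x; apply/idP/imfsetP => [Xx|[y Xy ->]//]; exists x.
Qed.

End Euclid.

(** ['S_2] serves as the group of signs, read off by [odd_perm]. *)
Lemma S2_comm (s t : 'S_2) : (s * t = t * s)%g.
Proof.
have /prime_cyclic/cyclic_abelian/centsP : prime #|[set: 'S_2]%G| by rewrite cardsT card_Sn.
by apply; rewrite inE.
Qed.

(** * Soluble transitive groups on the standard polytopes *)

Section Orbits.
Variable R : realType.

Lemma coordsE d (s : seq R) i : coords d s 0 i = s`_i.
Proof. by rewrite mxE. Qed.

Definition angle n (k : nat) : R := 2 * pi * k%:R / n%:R.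
Definition circle_pt n (k : nat) : 'rV[R]_2 := coords 2 [:: cos (angle n k); sin (angle n k)].

Lemma sqdist_circle n j k :
  sqdist (circle_pt n j) (circle_pt n k) = 2 - 2 * cos (angle n j - angle n k).
Proof.
rewrite /sqdist !big_ord_recl big_ord0 !coordsE /= cosB.
have := cos2Dsin2 (angle n j); have := cos2Dsin2 (angle n k); nra.
Qed.

Lemma circle_pt_mod n k : (0 < n)%N -> circle_pt n (k %% n) = circle_pt n k.
Proof.
move=> n0; have n0R : (n%:R : R) != 0 by rewrite pnatr_eq0 -lt0n.
have -> : circle_pt n k = circle_pt n (k %/ n * n + k %% n) by rewrite -divn_eq.
rewrite /circle_pt.
have -> : angle n (k %/ n * n + k %% n) = angle n (k %% n) + (pi *+ 2) *+ (k %/ n).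
  by rewrite /angle natrD natrM -[_ *+ (k %/ n)]mulr_natr -[pi *+ 2]mulr_natl; field.
by rewrite (periodicn (@cosD2pi R)) (periodicn (@sinD2pi R)).
Qed.

(** The rotations form Z/n, and a chord depends only on the difference of the indices. *)
Lemma soluble_set_polygon n : (0 < n)%N -> soluble_set (polygon R n).
Proof.
case: n => // n _; apply: (@soluble_set_orbit _ _ 'I_n.+1 (fun k => circle_pt n.+1 k)).
- by apply: soluble_group_abelian => x y; exact: Zp_mulgC.
- move=> g h k; rewrite !circle_pt_mod // !sqdist_circle; congr (_ - _ * cos _).
  by rewrite /angle !natrD; ring.
- by move=> x; split=> [/imfsetP[k _ ->]|[k ->]]; [exists k|apply/imfsetP; exists k].
Qed.

Lemma regular_simplex_enum d (X : {fset 'rV[R]_d}) : regular_simplex X ->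
  exists p : 'I_d.+1 -> 'rV[R]_d, (forall x, x \in X <-> exists k, x = p k) /\
    exists2 a, 0 < a & forall j k, sqdist (p j) (p k) = (j != k)%:R * a ^+ 2.
Proof.
move=> [cardX [a a0 distX]]; pose p (k : 'I_d.+1) := (enum_fset X)`_k.
have sX : size (enum_fset X) = d.+1 by rewrite -cardX.
have pX k : p k \in X by apply: mem_nth; rewrite sX.
exists p; split=> [x|].
  split=> [Xx|[k ->//]].
  have ix : (index x (enum_fset X) < d.+1)%N by rewrite -sX index_mem.
  by exists (Ordinal ix); rewrite /p nth_index.
exists a => // j k; have [->|jk] := eqVneq j k; first by rewrite sqdistxx mul0r.
by rewrite -sqr_eucl_dist distX ?nth_uniq ?sX ?fset_uniq // mul1r.
Qed.

(** All nonzero distances agree, so every simply transitive group acts by isometries; the cyclic one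
    is abelian. *)
Lemma soluble_set_simplex d (X : {fset 'rV[R]_d}) : regular_simplex X -> soluble_set X.
Proof.
move=> /regular_simplex_enum[p [pX [a _ pE]]]; apply: (@soluble_set_orbit _ _ 'I_d.+1 p) => //.
- by apply: soluble_group_abelian => x y; exact: Zp_mulgC.
- by move=> g h k; rewrite !pE (inj_eq (mulgI g)).
Qed.

(** Cyclic shifts of the axes and a global sign are already transitive, and they form an abelian
    group in every dimension. *)
Lemma soluble_set_orthoplex d : (0 < d)%N -> soluble_set (orthoplex R d).
Proof.
case: d => // d _.
pose p (x : 'I_d.+1 * 'S_2) : 'rV[R]_d.+1 := (-1) ^+ odd_perm x.2 *: delta_mx 0 x.1.
have pM g h j : p (g * h)%g 0 (g.1 * j)%g = (-1) ^+ odd_perm g.2 * p h 0 j.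
  by rewrite !mxE odd_permM signr_addb mulrA (inj_eq (mulgI _)).
apply: (@soluble_set_orbit _ _ ('I_d.+1 * 'S_2)%type p).
- apply: soluble_group_abelian => -[i s] [j t]; congr pair; first exact: Zp_mulgC.
  exact: S2_comm.
- move=> g h k; rewrite /sqdist (reindex_inj (mulgI g.1)).
  by apply: eq_bigr => j _; rewrite !pM -mulrBr exprMn sqrr_sign mul1r.
- move=> x; rewrite in_fsetU; split.
    case/orP=> /imfsetP[i _ ->].
      by exists (i, 1%g); rewrite /p odd_perm1 scale1r.
    by exists (i, tperm 0 1); rewrite /p odd_tperm scaleN1r.
  move=> [[i s] ->]; rewrite /p /=; case: odd_perm; apply/orP.
    by right; rewrite scaleN1r; apply/imfsetP; exists i.
  by left; rewrite scale1r; apply/imfsetP; exists i.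
Qed.

Definition signed_act d (H : {group 'S_d}) (g : wreath 'S_2 H) (v : 'rV[R]_d) : 'rV[R]_d :=
  \row_i ((-1) ^+ odd_perm (g.1 i) * v 0 (sgval g.2 i)).

Lemma signed_actM d (H : {group 'S_d}) (g h : wreath 'S_2 H) v :
  signed_act (g * h)%g v = signed_act g (signed_act h v).
Proof.
by apply/rowP => i; rewrite !mxE !ffunE odd_permM signr_addb permM mulrA.
Qed.

Lemma sqdist_signed_act d (H : {group 'S_d}) (g : wreath 'S_2 H) v w :
  sqdist (signed_act g v) (signed_act g w) = sqdist v w.
Proof.
rewrite [RHS](reindex_inj (@perm_inj _ (sgval g.2))); apply: eq_bigr => i _.
by rewrite !mxE -mulrBr exprMn sqrr_sign mul1r.
Qed.

Lemma signed_permsP d (H : {group 'S_d}) (v x : 'rV[R]_d) :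
  x \in signed_perms H v <-> exists g : wreath 'S_2 H, x = signed_act g v.
Proof.
split=> [/imfset2P[E _ [s Hs ->]]|[[f s] ->]].
  exists ([ffun i => if i \in E then tperm 0 1 else 1%g], subg H s).
  by apply/rowP => i; rewrite !mxE ffunE subgK //; case: ifP; rewrite ?odd_tperm ?odd_perm1.
apply/imfset2P; exists [set i | odd_perm (f i)]%SET; first by rewrite inE.
exists (sgval s); first exact: subgP.
by apply/rowP => i; rewrite !mxE inE.
Qed.

Lemma soluble_set_signed_perms d (H : {group 'S_d}) (v : 'rV[R]_d) :
  solvable H -> soluble_set (signed_perms H v).
Proof.
move=> solH; apply: (@soluble_set_orbit _ _ (wreath 'S_2 H) (fun g => signed_act g v)).
- apply: soluble_wreath solH; apply/soluble_group_fin.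
  by apply: solvable_small_degree; rewrite card_ord.
- by move=> g h k; rewrite !signed_actM sqdist_signed_act.
- exact: signed_permsP.
Qed.

(** Permuting equal coordinates does nothing, so sign changes alone give all vertices and the
    permutation group can be taken trivial. *)
Lemma soluble_set_hypercube d : soluble_set (hypercube R d).
Proof.
suff -> : hypercube R d = signed_perms 1%G (const_mx 1).
  by apply: soluble_set_signed_perms; exact: solvable1.
apply/fsetP => x; apply/imfset2P/imfset2P => -[E EE [s _ ->]]; exists E => //.
  by exists 1%g; rewrite ?inE //; apply/rowP => i; rewrite !mxE.
by exists 1%g; rewrite ?inE //; apply/rowP => i; rewrite !mxE.
Qed.

Lemma even_permsE d : even_perms d = ('Alt_('I_d))%g.
Proof. by apply/setP => s; rewrite inE Alt_even. Qed.

(** Sign changes and even coordinate permutations are transitive on the vertices, although the full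
    symmetry group contains the insoluble group A_5. *)
Lemma soluble_set_icosahedron : soluble_set (icosahedron R).
Proof.
rewrite /icosahedron even_permsE; apply: soluble_set_signed_perms.
by apply: solvable_small_degree; rewrite card_ord.
Qed.

Lemma soluble_set_cell24 : soluble_set (cell24 R).
Proof.
apply: (@soluble_set_signed_perms _ [set: 'S_4]%G).
by apply: solvable_small_degree; rewrite card_ord.
Qed.

End Orbits.

(** * Symmetry groups *)

Section Symmetries.
Variable R : realType.

(** The parallel axis (Huygens-Steiner) identity. *)
Lemma sqdist_weighted d (I : finType) (w : I -> R) (q : I -> 'rV[R]_d) (z : 'rV[R]_d) :
  let m := \sum_i w i *: q i in \sum_i w i = 1 ->
  \sum_i w i * sqdist z (q i) = sqdist z m + \sum_i w i * sqdist (q i) m.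
Proof.
move=> m w1; rewrite /sqdist.
under eq_bigr do rewrite mulr_sumr.
under [X in _ = _ + X]eq_bigr do rewrite mulr_sumr.
rewrite exchange_big [X in _ = _ + X]exchange_big -big_split; apply: eq_bigr => k _ /=.
have mE : m 0 k = \sum_i w i * q i 0 k.
  by rewrite /m summxE; apply: eq_bigr => i _; rewrite mxE.
have expand t : \sum_i w i * (t - q i 0 k) ^+ 2 =
    t ^+ 2 - 2 * t * m 0 k + \sum_i w i * q i 0 k ^+ 2.
  have -> : t ^+ 2 = \sum_i w i * t ^+ 2 by rewrite -mulr_suml w1 mul1r.
  rewrite mE mulr_sumr -sumrB -big_split.
  by apply: eq_bigr => i _ /=; ring.
under [X in _ = _ + X]eq_bigr do rewrite -sqrrN opprB.
by rewrite !expand; ring.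
Qed.

Definition isom_set d (X : {fset 'rV[R]_d}) : {set {perm X}} :=
  [set s : {perm X} | [forall x, forall y,
     sqdist (val (s x)) (val (s y)) == sqdist (val x) (val y)]]%SET.

Lemma isom_setP d (X : {fset 'rV[R]_d}) (s : {perm X}) :
  reflect (forall x y, sqdist (val (s x)) (val (s y)) = sqdist (val x) (val y))
          (s \in isom_set X).
Proof.
rewrite inE; apply: (iffP forallP) => [sX x y|sX x]; first by move/forallP: (sX x) => /(_ y)/eqP.
by apply/forallP => y; rewrite sX.
Qed.

Lemma isom_group_set d (X : {fset 'rV[R]_d}) : group_set (isom_set X).
Proof.
apply/group_setP; split; first by apply/isom_setP => x y; rewrite !perm1.
by move=> s t /isom_setP sE /isom_setP tE; apply/isom_setP => x y; rewrite !permM tE.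
Qed.
Canonical isom_group d (X : {fset 'rV[R]_d}) := Group (isom_group_set X).

Definition centroid d (X : {fset 'rV[R]_d}) : 'rV[R]_d := \sum_(x : X) (#|{: X}|%:R)^-1 *: val x.

(** By transitivity the mean squared distance to the set is the same from each of its points. By the
    parallel axis identity it differs from the squared distance to the centroid by a constant. *)
Lemma soluble_set_cospherical d (X : {fset 'rV[R]_d}) :
  soluble_set X -> exists r, {in X, forall x, sqdist x (centroid X) = r}.
Proof.
have [->|[x0 Xx0]] := fset_0Vmem X; first by exists 0.
move=> [G [act [_ _ iso trans]]].
have X0 : (#|{: X}|%:R : R) != 0.
  by rewrite pnatr_eq0 -lt0n; apply/card_gt0P; exists [` Xx0]%fset.
exists (sqdist x0 (centroid X)) => x Xx.
have [g gE] := trans [` Xx0]%fset [` Xx]%fset.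
have isoS y z : sqdist (val (act g y)) (val (act g z)) = sqdist (val y) (val z).
  exact/eucl_dist_eq.
have g_inj : injective (act g).
  by move=> y z yz; apply: val_inj; apply: sqdist0; rewrite -isoS yz sqdistxx.
have w1 : \sum_(y : X) (#|{: X}|%:R : R)^-1 = 1.
  by rewrite sumr_const -[LHS]mulr_natr mulVf.
have mean z := sqdist_weighted (fun y : X => val y) z w1.
have := mean x0; have := mean x; rewrite -/(centroid X).
rewrite (reindex_inj g_inj).
have -> : \sum_y #|{: X}|%:R^-1 * sqdist x (val (act g y)) =
    \sum_(y : X) #|{: X}|%:R^-1 * sqdist x0 (val y).
  by apply: eq_bigr => y _; rewrite -(isoS [` Xx0]%fset y) gE.
by move=> -> /addIr.
Qed.

(** * Symmetries of the convex hull of a cospherical set *)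

Section Cospherical.
Variables (d : nat) (X : {fset 'rV[R]_d}) (r : R).
Hypothesis sphX : {in X, forall x, sqdist x (centroid X) = r}.
Let c := centroid X.

Lemma hull_sqdist (w : X -> R) : \sum_x w x = 1 ->
  let y := \sum_x w x *: val x in sqdist c y + \sum_x w x * sqdist (val x) y = r.
Proof.
move=> w1 y; rewrite -(sqdist_weighted (fun x : X => val x)) //.
under eq_bigr => x _ do rewrite sqdistC sphX ?(valP x) //.
by rewrite -mulr_suml w1 mul1r.
Qed.

Lemma hull_le y : convex_hull X y -> sqdist y c <= r.
Proof.
move=> [w [w0 w1 ->]]; rewrite sqdistC -(hull_sqdist w1) lerDl.
by apply: sumr_ge0 => x _; rewrite mulr_ge0 ?sqdist_ge0.
Qed.

(** In the case of equality the weighted scatter about [y] vanishes, so a point of nonzero weight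
    coincides with [y]. *)
Lemma hull_vertex y : convex_hull X y -> sqdist y c = r -> y \in X.
Proof.
move=> [w [w0 w1 yE]] yr; have /= := hull_sqdist w1; rewrite -yE sqdistC yr.
move/(canRL (addKr _)); rewrite addNr => /eqP; rewrite psumr_eq0 => [/allP wy|x _]; last first.
  by rewrite mulr_ge0 ?sqdist_ge0.
have /existsP[x wx] : [exists x, w x != 0].
  apply: contraT; rewrite negb_exists => /forallP w00.
  move/eqP: w1; rewrite big1 ?(eq_sym 0) ?oner_eq0 // => x _.
  by apply/eqP; rewrite -[_ == _]negbK.
have := wy x (mem_index_enum _); rewrite mulf_eq0 (negbTE wx) => /eqP/sqdist0 <-.
exact: valP.
Qed.

Lemma vertex_hull x : x \in X -> convex_hull X x.
Proof.
move=> Xx; exists (fun y => (y == [` Xx]%fset)%:R); split=> [y||].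
- exact: ler0n.
- by rewrite (bigD1 [` Xx]%fset) //= eqxx big1 ?addr0 // => y /negbTE->.
- rewrite (bigD1 [` Xx]%fset) //= eqxx scale1r big1 ?addr0 // => y /negbTE->.
  by rewrite scale0r.
Qed.

Lemma symmetry_sqdist (f : symmetries (convex_hull X)) x y :
  sqdist (sval f x) (sval f y) = sqdist x y.
Proof. by case: (svalP f) => fE _ _; apply/eucl_dist_eq. Qed.

(** Each vertex is the image of a hull point, so its squared distance to [sval f c] is at most [r].
    Their mean exceeds [r] by the squared distance from [sval f c] to [c], which must therefore
    vanish. *)
Lemma symmetry_centroid (f : symmetries (convex_hull X)) x :
  x \in X -> sval f c = c.
Proof.
move=> Xx; have [_ _ fX] := svalP f.
have X0 : (0 < #|{: X}|)%N by apply/card_gt0P; exists [` Xx]%fset.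
have w1 : \sum_(y : X) (#|{: X}|%:R : R)^-1 = 1.
  by rewrite sumr_const -[LHS]mulr_natr mulVf // pnatr_eq0 -lt0n.
have := sqdist_weighted (fun y : X => val y) (sval f c) w1; rewrite -/(centroid X) -/c.
under [X in _ = _ + X -> _]eq_bigr => y _ do rewrite sphX ?(valP y) //.
rewrite -mulr_suml w1 mul1r => mean; apply: sqdist0; apply/eqP.
rewrite eq_le sqdist_ge0 andbT -(lerD2r r) -mean add0r.
have -> : r = \sum_(y : X) (#|{: X}|%:R)^-1 * r by rewrite -mulr_suml w1 mul1r.
apply: ler_sum => y _; rewrite ler_wpM2l ?invr_ge0 ?ler0n //.
have : convex_hull X (val y) by apply: vertex_hull; exact: valP.
by rewrite -{1}fX => -[h hullh <-]; rewrite symmetry_sqdist sqdistC hull_le.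
Qed.

Lemma symmetry_vertex (f : symmetries (convex_hull X)) x : x \in X -> sval f x \in X.
Proof.
move=> Xx; have [_ _ fX] := svalP f; apply: hull_vertex.
  have : (sval f @` convex_hull X)%classic (sval f x).
    by exists x => //; exact: vertex_hull.
  by rewrite fX.
by rewrite -(symmetry_centroid f Xx) symmetry_sqdist sphX.
Qed.

Definition symmetry_fun (f : symmetries (convex_hull X)) (x : X) : X :=
  [` symmetry_vertex f (valP x)]%fset.

Lemma symmetry_fun_inj f : injective (symmetry_fun f).
Proof.
move=> x y /(congr1 val)/= xy; apply: val_inj; apply: sqdist0.
by rewrite -(symmetry_sqdist f) xy sqdistxx.
Qed.

Definition symmetry_perm f : {perm X} := perm (@symmetry_fun_inj f).

Lemma symmetry_perm_isom f : symmetry_perm f \in isom_group X.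
Proof. by apply/isom_setP => x y; rewrite !permE symmetry_sqdist. Qed.

End Cospherical.

(** Affine spanning, stated through differences of points so that Gram matrices can detect it. *)
Definition frame d (X : {fset 'rV[R]_d}) : Prop :=
  exists a b : 'I_d -> 'rV[R]_d,
    (forall j, a j \in X /\ b j \in X) /\ (\matrix_(j < d) (a j - b j)) \in unitmx.

Lemma polarization d (a b a' b' : 'rV[R]_d) :
  2 * ((a - b) *m (a' - b')^T) 0 0 =
  sqdist a b' + sqdist b a' - sqdist a a' - sqdist b b'.
Proof.
rewrite mxE mulr_sumr /sqdist -big_split -!sumrB; apply: eq_bigr => i _ /=.
by rewrite !mxE; ring.
Qed.

(** The similarity is not known to be affine, but polarization expresses the Gram matrix of the
    differences by distances. It is multiplied by [c ^+ 2] and stays invertible. *)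
Lemma frame_scaled d (V X : {fset 'rV[R]_d}) :
  similar_copy V X -> frame V -> frame X.
Proof.
move=> [c c0 [f [fE ->]]] [a [b [Vab unitV]]].
have fS x y : x \in V -> y \in V -> sqdist (f x) (f y) = c ^+ 2 * sqdist x y.
  by move=> Vx Vy; apply/eucl_dist_scale; [exact: ltW|exact: fE].
exists (f \o a), (f \o b); split=> [j|].
  by have [Va Vb] := Vab j; split; apply: in_imfset.
set M := (X in X \in unitmx).
suff MM : M *m M^T = (c ^+ 2) *: ((\matrix_j (a j - b j)) *m (\matrix_j (a j - b j))^T).
  have : M *m M^T \in unitmx.
    by rewrite MM unitmxZ ?unitfE ?expf_neq0 ?gt_eqF // unitmx_mul unitmx_tr unitV.
  by rewrite unitmx_mul => /andP[].
have rowdot (A : 'M[R]_d) j k : (A *m A^T) j k = (row j A *m (row k A)^T) 0 0.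
  by rewrite !mxE; apply: eq_bigr => i _; rewrite !mxE.
apply/matrixP => j k; rewrite [RHS]mxE !rowdot !rowK.
have [[Vaj Vbj] [Vak Vbk]] := (Vab j, Vab k).
apply: (@mulfI _ 2); rewrite ?pnatr_eq0 // polarization mulrCA polarization !fS //.
by ring.
Qed.

(** The points [f y] and [y] are equally far from every fixed point, so by polarization [f y - y] is
    orthogonal to a basis. *)
Lemma isometry_fixing_frame d (X : {fset 'rV[R]_d}) (f : 'rV[R]_d -> 'rV[R]_d) :
  frame X -> (forall x y, sqdist (f x) (f y) = sqdist x y) ->
  {in X, forall x, f x = x} -> forall y, f y = y.
Proof.
move=> [a [b [Xab unitX]]] fE fX y; apply/eqP; rewrite -subr_eq0; apply/eqP.
rewrite -unitmx_tr in unitX; rewrite -[LHS](mulmxK unitX).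
suff -> : (f y - y) *m (\matrix_j (a j - b j))^T = 0 by rewrite mul0mx.
apply/rowP => j; rewrite [RHS]mxE; have [Xa Xb] := Xab j.
apply: (@mulfI _ 2); rewrite ?pnatr_eq0 // mulr0.
have -> : ((f y - y) *m (\matrix_j (a j - b j))^T) 0 j = ((f y - y) *m (a j - b j)^T) 0 0.
  by rewrite !mxE; apply: eq_bigr => i _; rewrite !mxE.
rewrite polarization -{1}(fX _ Xb) -{2}(fX _ Xa) !fE; ring.
Qed.

Lemma soluble_symmetry_group d (X : {fset 'rV[R]_d}) :
  soluble_set X -> frame X -> solvable (isom_group X) -> soluble_group (symmetry_group X).
Proof.
move=> /soluble_set_cospherical[r sphX] frameX solX.
(* The inverse reconciles composition of functions, right to left, with the product of permutations,
   left to right. *)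
pose phi (f : symmetry_group X) : subg_of (isom_group X) :=
  (subg (isom_group X) (symmetry_perm sphX f))^-1%g.
apply: (@soluble_group_embed _ _ phi); last exact: soluble_subg.
  move=> f g; rewrite /phi -invMg; congr (_^-1)%g.
  rewrite -subgM ?symmetry_perm_isom //; congr (subg _ _).
  by apply/permP => x; apply: val_inj; rewrite permM !permE.
move=> f /(canRL invgK); rewrite invg1 => /(congr1 sgval).
rewrite subgK ?symmetry_perm_isom // => f1.
apply: symmetry_inj => y; apply: (isometry_fixing_frame frameX).
  exact: symmetry_sqdist.
by move=> x Xx; have /permP/(_ [` Xx]%fset)/(congr1 val) := f1; rewrite permE perm1.
Qed.

End Symmetries.

(** * Isometries of regular polygons as affine maps of Z/n *)

Section Polygons.
Variable R : realType.

Lemma cos_angle_eq n k m : (k.*2 <= n)%N -> (m < n)%N ->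
  cos (angle R n m) = cos (angle R n k) -> m = k \/ (m + k)%N = n.
Proof.
move=> k2 mn; have n0 : (0 < n%:R :> R) by rewrite ltr0n (leq_ltn_trans _ mn).
have itv j : (j.*2 <= n)%N -> angle R n j \in `[0, pi].
  move=> j2; rewrite in_itv /=; apply/andP; split.
    by rewrite !mulr_ge0 ?invr_ge0 ?ler0n // pi_ge0.
  rewrite ler_pdivrMr // -mulrA mulrCA ler_wpM2l ?pi_ge0 //.
  by rewrite -natrM ler_nat mul2n.
have angle_inj i j : angle R n i = angle R n j -> i = j.
  move/(mulIf (invr_neq0 (lt0r_neq0 n0)))/(mulfI _) => ij; apply/eqP.
  by rewrite -(eqr_nat R); apply/eqP/ij; rewrite mulf_neq0 ?pnatr_eq0 // gt_eqF ?pi_gt0.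
have [m2|m2] := leqP m.*2 n.
  by move/cos_inj => mk; left; apply: angle_inj; apply: mk; exact: itv.
(* An angle beyond pi is reflected into the interval on which the cosine is injective. *)
have -> : angle R n m = - angle R n (n - m) + pi *+ 2.
  by rewrite /angle natrB ?(ltnW mn) // -[pi *+ 2]mulr_natl; field; rewrite gt_eqF.
rewrite cosD2pi cosN => /cos_inj mk; right; rewrite -(angle_inj (n - m)%N k) ?subnKC ?(ltnW mn) //.
by apply: mk; apply: itv => //; rewrite doubleB leq_subLR -addnn leq_add2r ltnW.
Qed.

Lemma circle_pt_distance n (i j : 'I_n.+2) k : (k.*2 <= n.+2)%N ->
  sqdist (circle_pt R n.+2 i) (circle_pt R n.+2 j) =
    sqdist (circle_pt R n.+2 0) (circle_pt R n.+2 k) ->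
  j = i + k%:R \/ j = i - k%:R.
Proof.
move=> k2; wlog ij : i j / (i <= j)%N.
  move=> wl; have [ij|/ltnW ji] := leqP i j; first exact: wl.
  rewrite sqdistC => /(wl _ _ ji)[->|->]; [right|left]; by rewrite ?addrK ?subrK.
rewrite !sqdist_circle => /addrI/oppr_inj/(mulfI _) eqcos.
have nat_ord (x : 'I_n.+2) : x = (x : nat)%:R by apply: val_inj; rewrite /= Zp_nat /= modn_small.
have n0 : n.+2%:R = 0 :> 'I_n.+2 by apply: val_inj; rewrite Zp_nat /= modnn.
have jE : j = i + (j - i)%:R by rewrite [LHS]nat_ord -{1}(subnKC ij) natrD -nat_ord.
have [] := @cos_angle_eq n.+2 k (j - i) k2.
- exact: leq_ltn_trans (leq_subr _ _) (ltn_ord j).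
- have -> : angle R n.+2 (j - i) = - (angle R n.+2 i - angle R n.+2 j).
    by rewrite /angle natrB //; ring.
  rewrite cosN eqcos ?pnatr_eq0 // -cosN; congr cos; rewrite /angle; ring.
- by move=> <-; left.
- move=> jk; right; rewrite {1}jE; congr (_ + _); apply/eqP.
  by rewrite -addr_eq0 -natrD jk n0.
Qed.

(** Neighbours go to neighbours, so each increment of [s] is 1 or -1. A change of sign would give
    [s (i + 2) = s i], impossible with at least three vertices; hence the increment is constant. *)
Lemma circle_isometry_affine n (s : 'I_n.+3 -> 'I_n.+3) :
  (forall i j, sqdist (circle_pt R n.+3 (s i)) (circle_pt R n.+3 (s j)) =
               sqdist (circle_pt R n.+3 i) (circle_pt R n.+3 j)) ->
  exists a b, forall i, s i = a * i + b.
Proof.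
move=> sE; have dist (k i : 'I_n.+3) :
    sqdist (circle_pt R n.+3 i) (circle_pt R n.+3 (i + k : 'I_n.+3)%R) =
    sqdist (circle_pt R n.+3 0) (circle_pt R n.+3 k).
  rewrite circle_pt_mod // !sqdist_circle; congr (_ - _ * cos _).
  by rewrite /angle !natrD; ring.
have step i : s (i + 1) = s i + 1 \/ s (i + 1) = s i - 1.
  by apply: (@circle_pt_distance _ _ _ 1) => //; rewrite sE (dist 1).
have two i : s (i + 1 + 1) != s i.
  apply/eqP => /(congr1 (fun j : 'I_n.+3 => sqdist (circle_pt R n.+3 (s i)) (circle_pt R n.+3 j))).
  rewrite sE sqdistxx -(sqdistxx (circle_pt R n.+3 0)).
  move/(@circle_pt_distance _ _ _ 0 isT); rewrite mulr0n subr0 addr0 -addrA.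
  by case=> /(canRL (addKr i)); rewrite addNr => /(congr1 val); rewrite /= !modn_small.
have step1 k : s (k%:R + 1) - s k%:R = s 1 - s 0.
  elim: k => [|k IHk]; first by rewrite add0r.
  rewrite -IHk -natr1; case: (step k%:R) (step (k%:R + 1)) (two k%:R) => -> [->|->];
    by rewrite ?addrK ?subrK ?eqxx // => _; ring.
exists (s 1 - s 0), (s 0) => i; rewrite -[i]natr_Zp.
elim: (i : nat) => [|k IHk]; first by rewrite mulr0 add0r.
by rewrite -natr1 -[LHS](subrK (s k%:R)) step1 IHk; ring.
Qed.

Lemma solvable_isom_polygon n (X : {fset 'rV[R]_2}) :
  (3 <= n)%N -> similar_copy (polygon R n) X -> solvable (isom_group X).
Proof.
case: n => [|[|[|n]]] // _ [c c0 [f [fE XE]]].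
pose q (k : 'I_n.+3) := f (circle_pt R n.+3 k).
have qP x : x \in X -> exists k, x = q k.
  by rewrite XE => /imfsetP[_ /imfsetP[k _ ->] ->]; exists k.
have Vk (k : 'I_n.+3) : circle_pt R n.+3 k \in polygon R n.+3 by apply/imfsetP; exists k.
have Xq k : q k \in X by rewrite XE; apply/imfsetP; exists (circle_pt R n.+3 k).
have qE j k : sqdist (q j) (q k) = c ^+ 2 * sqdist (circle_pt R n.+3 j) (circle_pt R n.+3 k).
  by apply/eucl_dist_scale; [exact: ltW|exact: fE].
pose lab (x : X) := sval (cid (qP _ (valP x))).
have labE x : q (lab x) = val x by rewrite /lab; case: cid.
apply: (@solvable_affine _ 'I_n.+3 lab) => [x y xy|s /isom_setP sX].
  by apply: val_inj; rewrite -!labE xy.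
have [j k|a [b sE]] := @circle_isometry_affine n (fun k => lab (s [` Xq k]%fset)).
  apply: (@mulfI _ (c ^+ 2)); first by rewrite expf_neq0 ?gt_eqF.
  by rewrite -!qE !labE sX.
exists a, b => x; rewrite -sE; congr (lab (s _)); apply: val_inj.
by rewrite /= labE.
Qed.

Lemma frame_polygon n : (3 <= n)%N -> frame (polygon R n).
Proof.
case: n => [|[|[|n]]] // _; set N := n.+3.
have n0 : (N%:R != 0 :> R) by rewrite pnatr_eq0.
have mem k : circle_pt R N k \in polygon R N.
  rewrite -circle_pt_mod //; apply/imfsetP.
  by exists (Ordinal (ltn_pmod k (isT : 0 < N)%N)).
(* The differences run from the vertices at angles 0 and -t to the one at angle t. The second is
   vertical, which makes the transposed matrix triangular. *)
exists (fun=> circle_pt R N 1),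
  (fun i : 'I_2 => if i == 0 then circle_pt R N 0 else circle_pt R N n.+2).
split=> [j|]; first by split; last case: ifP; rewrite mem.
set M := (X in X \in _); set t := angle R N 1.
have a0 : angle R N 0 = 0 by rewrite /angle mulr0 mul0r.
have a2 : angle R N n.+2 = - t + pi *+ 2.
  by rewrite /angle /t /angle -[n.+2]/(N - 1)%N natrB // -[pi *+ 2]mulr_natl; field.
have s0 : 0 < sin t.
  apply: sin_gt0_pi; rewrite /t /angle mulr1; apply/andP; split.
    by rewrite divr_gt0 ?mulr_gt0 ?pi_gt0 ?ltr0n.
  by rewrite ltr_pdivrMr ?ltr0n // mulrC ltr_pM2l ?pi_gt0 // ltr_nat.
have c1 : cos t != 1.
  apply/eqP => ct; have := cos2Dsin2 t; rewrite ct expr1n => /(canRL (addKr _))/eqP.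
  by rewrite addNr sqrf_eq0 gt_eqF.
have ME i j : M^T i j = (coords 2 [:: cos t; sin t] : 'rV[R]_2) 0 i -
    (if j == 0 then coords 2 [:: 1; 0] : 'rV[R]_2 else coords 2 [:: cos t; - sin t]) 0 i.
  rewrite !mxE; case: (j == 0); rewrite !mxE /= ?a0 ?cos0 ?sin0 //.
  by rewrite a2 cosD2pi sinD2pi cosN sinN.
rewrite -unitmx_tr unitmxE det_trig; last first.
  apply/is_trig_mxP => -[[|[|i]] Hi] [[|[|j]] Hj] // _.
  by rewrite ME !coordsE /= subrr.
rewrite !big_ord_recl big_ord0 mulr1 !ME !coordsE /= opprK unitfE mulf_neq0 //.
  by rewrite subr_eq0.
by rewrite gt_eqF ?addr_gt0.
Qed.

End Polygons.

(** * Polytopes with coordinates in -1, 0, 1 *)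

Section LatticePolytopes.
Variable R : realType.

Fixpoint sqdistz (l m : seq int) : int :=
  match l, m with
  | x :: l', y :: m' => (x - y) ^+ 2 + sqdistz l' m'
  | _, _ => 0
  end.

Fixpoint sign_words (d : nat) : seq (seq int) :=
  if d is d'.+1 then [seq x :: w | x <- [:: -1; 0; 1], w <- sign_words d'] else [:: [::]].

(** Up to scale, [k = d] gives the cube, [k = 1] the orthoplex, and [d = 4], [k = 2] the 24-cell, in
    integers on which [distance_tree] can be evaluated. *)
Definition sphere_words (d : nat) (k : int) : seq (seq int) :=
  [seq w <- sign_words d | sqdistz w (nseq d 0) == k].

Lemma sign_wordsP d w :
  size w = d -> all (fun z => z \in [:: -1; 0; 1]) w -> w \in sign_words d.
Proof.
elim: d w => [|d IHd] [|x w] //= [sw] /andP[xs ws].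
apply: (@allpairs_f _ _ _ cons [:: -1; 0; 1] (sign_words d)) => //.
exact: IHd.
Qed.

Definition of_word d (w : seq int) : 'rV[R]_d := coords d [seq z%:~R | z <- w].

Lemma sqdist_of_word d l m : size l = d -> size m = d ->
  sqdist (of_word d l) (of_word d m) = (sqdistz l m)%:~R.
Proof.
elim: d l m => [|d IHd] [|x l] [|y m] //=; first by rewrite /sqdist big_ord0.
move=> [sl] [sm]; rewrite intrD rmorphXn rmorphB /= -(IHd l m) // /sqdist big_ord_recl !coordsE.
by congr (_ + _); apply: eq_bigr => i _; rewrite !coordsE.
Qed.

Lemma sphere_wordsP d (k : int) (v : 'rV[R]_d) :
  (forall i, v 0 i \in [:: -1; 0; 1]) -> sqdist v 0 = k%:~R ->
  exists2 w, w \in sphere_words d k & size w = d /\ v = of_word d w.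
Proof.
move=> v01 vk; pose g (r : R) : int := if r == 1 then 1 else if r == -1 then -1 else 0.
have gK i : (g (v 0 i))%:~R = v 0 i.
  have := v01 i; rewrite /g !inE => /or3P[]/eqP->; rewrite ?eqxx //.
    by case: eqP => [->|_]; rewrite ?rmorphN.
  by rewrite eq_sym oner_eq0 eq_sym oppr_eq0 oner_eq0.
pose w := [seq g (v 0 i) | i <- enum 'I_d].
have sw : size w = d by rewrite size_map size_enum_ord.
have vw : v = of_word d w.
  apply/rowP => i; rewrite coordsE -map_comp (nth_map i) ?size_enum_ord //=.
  by rewrite nth_ord_enum gK.
exists w => //; rewrite mem_filter sign_wordsP ?andbT //.
  rewrite -(eqr_int R) -vk vw -(@sqdist_of_word d) ?size_nseq //; apply/eqP; congr sqdist.
  by apply/rowP => i; rewrite coordsE mxE map_nseq nth_nseq if_same.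
apply/allP => _ /mapP[i _ ->]; rewrite /g.
by case: ifP => // _; case: ifP.
Qed.

Lemma solvable_isom_sphere_words d k (V X : {fset 'rV[R]_d}) Vs :
  (forall v, v \in V -> (forall i, v 0 i \in [:: -1; 0; 1]) /\ sqdist v 0 = k%:~R) ->
  similar_copy V X ->
  distance_tree sqdistz (sphere_words d k) (fun _ _ => true) (rcons Vs [:: 0]) ->
  solvable (isom_group X).
Proof.
move=> Vk [c c0 [f [fE XE]]] tree.
have labP x : x \in X -> exists w, [/\ w \in sphere_words d k, size w = d,
    of_word d w \in V & x = f (of_word d w)].
  rewrite XE => /imfsetP[v /= Vv ->]; have [v01 vk] := Vk v Vv.
  have [w Lw [sw vE]] := sphere_wordsP v01 vk.
  by exists w; rewrite -vE.
pose lab (x : X) := sval (cid (labP _ (valP x))).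
have labS (x : X) : [/\ lab x \in sphere_words d k, size (lab x) = d,
    of_word d (lab x) \in V & val x = f (of_word d (lab x))].
  exact: svalP (cid (labP _ (valP x))).
have labE (x y : X) : sqdist (val x) (val y) = c ^+ 2 * (sqdistz (lab x) (lab y))%:~R.
  have [[_ sx Vx xE] [_ sy Vy yE]] := (labS x, labS y).
  rewrite -(sqdist_of_word sx sy) xE yE; apply/eucl_dist_scale; first exact: ltW.
  exact: fE.
apply: (@solvable_distance_tree _ _ _ sqdistz (sphere_words d k) lab Vs) => //.
- by move=> x; have [] := labS x.
- move=> s /isom_setP sX x y; apply/eqP; rewrite -(eqr_int R); apply/eqP.
  apply: (@mulfI _ (c ^+ 2)); first by rewrite expf_neq0 ?gt_eqF.
  by rewrite -!labE sX.
- move=> x y xy; apply: val_inj; apply: sqdist0.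
  by rewrite labE xy mulr0.
Qed.

Lemma signed_perms_sphere d (v : 'rV[R]_d) x :
  (forall i, v 0 i \in [:: -1; 0; 1]) -> x \in signed_perms (all_perms d) v ->
  (forall i, x 0 i \in [:: -1; 0; 1]) /\ sqdist x 0 = sqdist v 0.
Proof.
move=> v01 /(@signed_permsP _ _ [set: 'S_d]%G)[g ->]; split=> [i|].
  rewrite mxE; case: odd_perm; last by rewrite mul1r.
  have := v01 (sgval g.2 i); rewrite mulN1r !inE => /or3P[]/eqP->;
    by rewrite ?opprK ?oppr0 eqxx ?orbT.
rewrite -[in LHS](_ : signed_act g 0 = 0) ?sqdist_signed_act //.
by apply/rowP => i; rewrite !mxE mulr0.
Qed.

Lemma solvable_isom_hypercube d (X : {fset 'rV[R]_d}) Vs :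
  similar_copy (hypercube R d) X ->
  distance_tree sqdistz (sphere_words d d) (fun _ _ => true) (rcons Vs [:: 0]) ->
  solvable (isom_group X).
Proof.
apply: solvable_isom_sphere_words => v /signed_perms_sphere[|v01 ->].
  by move=> i; rewrite mxE !inE eqxx !orbT.
split=> //; rewrite /sqdist; under eq_bigr do rewrite !mxE subr0 expr1n.
by rewrite sumr_const card_ord.
Qed.

Lemma solvable_isom_orthoplex d (X : {fset 'rV[R]_d}) Vs :
  similar_copy (orthoplex R d) X ->
  distance_tree sqdistz (sphere_words d 1) (fun _ _ => true) (rcons Vs [:: 0]) ->
  solvable (isom_group X).
Proof.
apply: solvable_isom_sphere_words => v Vv.
have {Vv}[i [b ->]] : exists i (b : bool), v = (-1) ^+ b *: delta_mx 0 i.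
  move: Vv; rewrite in_fsetU => /orP[]/imfsetP[i _ ->]; exists i.
    by exists false; rewrite scale1r.
  by exists true; rewrite scaleN1r.
split=> [j|].
  rewrite !mxE eqxx /=; case: (j == i); case: b;
    by rewrite !inE ?mulr0 ?mulr1 ?expr0 ?expr1 eqxx ?orbT.
rewrite /sqdist (bigD1 i) //= !mxE !eqxx mulr1 subr0 sqrr_sign big1 ?addr0 // => j ji.
by rewrite !mxE (negbTE ji) andbF mulr0 subr0 expr0n.
Qed.

Lemma solvable_isom_cell24 (X : {fset 'rV[R]_4}) :
  similar_copy (cell24 R) X -> solvable (isom_group X).
Proof.
(* The 24-cell splits into three 16-cells, within which squared distances are 0, 4, 8; each of these
   splits into four antipodal pairs, at squared distance 8. *)
move=> VX; apply: (@solvable_isom_sphere_words 4 2 _ _ [:: [:: 0; 4; 8]; [:: 0; 8]] _ VX).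
  move=> v /signed_perms_sphere[|v01 ->].
    by case=> [[|[|[|[|i]]]] Hi] //; rewrite coordsE !inE eqxx ?orbT.
  by split=> //; rewrite /sqdist !big_ord_recl big_ord0 !coordsE !mxE /=; ring.
by vm_compute.
Qed.

Lemma scalar2_unitmx d : (2%:M : 'M[R]_d) \in unitmx.
Proof. by rewrite -scalemx1 unitmxZ ?unitmx1 // unitfE pnatr_eq0. Qed.

Lemma frame_hypercube d : frame (hypercube R d).
Proof.
exists (fun=> const_mx 1), (fun j => \row_i (-1) ^+ (i == j)); split=> [j|].
  split; apply/(@signed_permsP _ _ [set: 'S_d]%G).
    by exists 1%g; apply/rowP => i; rewrite !mxE ffunE odd_perm1 mulr1.
  exists ([ffun i => if i == j then tperm 0 1 else 1%g], 1%g).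
  by apply/rowP => i; rewrite !mxE ffunE mulr1; case: eqP; rewrite ?odd_tperm ?odd_perm1.
rewrite (_ : \matrix_(j < d) _ = 2%:M) ?scalar2_unitmx //.
apply/matrixP => j i; rewrite !mxE eq_sym; case: eqP => _ /=; last by rewrite subrr.
by rewrite expr1 opprK.
Qed.

Lemma frame_orthoplex d : frame (orthoplex R d).
Proof.
exists (delta_mx 0), (fun j => - delta_mx 0 j); split=> [j|].
  by rewrite !in_fsetU; split; apply/orP; [left|right]; apply/imfsetP; exists j.
rewrite (_ : \matrix_(j < d) _ = 2%:M) ?scalar2_unitmx //.
apply/matrixP => j i; rewrite !mxE opprK eqxx /= eq_sym.
by case: eqP => _ /=; rewrite ?addr0 // ?mulr1n ?mulr0n.
Qed.

Lemma cell24_mem (E : {set 'I_4}) (i j : 'I_4) : i != j ->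
  \row_k ((-1) ^+ (k \in E) * ((k == i) || (k == j))%:R) \in cell24 R.
Proof.
move=> ij; apply/imfset2P; exists E; first by rewrite inE.
(* The first transposition takes [i] to 0, the second takes the image of [j] to 1; that image is not
   0, so 0 stays in place. *)
exists (tperm i 0 * tperm (tperm i 0 j) 1%R)%g; first by rewrite inE.
set s := (_ * _)%g.
have nz : tperm i 0 j != 0.
  by rewrite -[X in _ != X](tpermL i 0) (inj_eq perm_inj) eq_sym.
have si : s i = 0 by rewrite permM tpermL (tpermD nz (oner_neq0 _)).
have sj : s j = 1 by rewrite permM tpermL.
apply/rowP => k; rewrite !mxE; congr (_ * _).
rewrite -(inj_eq (@perm_inj _ s)) -(inj_eq (@perm_inj _ s) k j) si sj.
by case: (s k) => [[|[|[|[|]]]] H].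
Qed.

(** Reversing the sign at [j] of the vertex supported on [j] and [j + 1] (cyclically) changes it by
    twice a unit vector. *)
Lemma frame_cell24 : frame (cell24 R).
Proof.
pose v (E : {set 'I_4}) (j : 'I_4) : 'rV[R]_4 :=
  \row_k ((-1) ^+ (k \in E) * ((k == j) || (k == j + 1))%:R).
exists (v finset.set0), (fun j => v [set j]%SET j); split=> [j|].
  by split; apply: cell24_mem; rewrite -subr_eq0 opprD addNKr oppr_eq0.
rewrite (_ : \matrix_(j < 4) _ = 2%:M) ?scalar2_unitmx //.
apply/matrixP => j i; rewrite !mxE !inE eq_sym mul1r.
have [->|_] /= := eqVneq i j; last by rewrite mul1r subrr.
by rewrite mulr1 expr1 opprK.
Qed.

Lemma solvable_isom_simplex3 (X : {fset 'rV[R]_3}) :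
  regular_simplex X -> solvable (isom_group X).
Proof. by move=> [cX _]; apply: solvable_small_degree; rewrite -cardfE cX. Qed.

(** The Gram matrix of the edges at one vertex is a multiple of I + J, with J the all-ones matrix,
    and I + J has inverse I - J / (d + 1). *)
Lemma frame_simplex d (X : {fset 'rV[R]_d}) : regular_simplex X -> frame X.
Proof.
move=> /regular_simplex_enum[p [pX [a a0 pE]]].
exists (fun j => p (lift 0 j)), (fun=> p 0).
split=> [j|]; first by split; apply/pX; [exists (lift 0 j)|exists 0].
set M := (X in X \in unitmx).
have MM : M *m M^T = (a ^+ 2 / 2) *: (1%:M + const_mx 1).
  apply/matrixP => j k; apply: (@mulfI _ 2); rewrite ?pnatr_eq0 //.
  have -> : (M *m M^T) j k = ((p (lift 0 j) - p 0) *m (p (lift 0 k) - p 0)^T) 0 0.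
    by rewrite !mxE; apply: eq_bigr => i _; rewrite !mxE.
  rewrite polarization !pE !mxE (inj_eq (@lift_inj _ _)) !eqxx.
  rewrite [lift 0 j == 0]eq_sym (negbTE (neq_lift _ _)) (neq_lift 0 k).
  by case: (j == k) => /=; field.
have : M *m M^T \in unitmx.
  rewrite MM unitmxZ; last by rewrite unitfE mulf_neq0 ?expf_neq0 ?gt_eqF ?invr_gt0.
  have JJ : (const_mx 1 : 'M[R]_d) *m (const_mx 1 : 'M[R]_d) = d%:R *: const_mx 1.
    apply/matrixP => j k; rewrite !mxE mulr1.
    by under eq_bigr do rewrite !mxE mulr1; rewrite sumr_const card_ord.
  suff /mulmx1_unit[] :
      (1%:M + const_mx 1) *m (1%:M - (d.+1%:R)^-1 *: const_mx 1) = 1%:M :> 'M[R]_d.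
    by [].
  rewrite mulmxDl !mulmxBr !mul1mx mulmx1 -scalemxAr JJ scalerA.
  apply/matrixP => j k; rewrite !mxE.
  have d0 : d.+1%:R != 0 :> R by rewrite pnatr_eq0.
  by rewrite -natr1 in d0 *; field.
by rewrite unitmx_mul => /andP[].
Qed.

End LatticePolytopes.

(** * The dodecahedron *)

Section AffineGroup.
Variable n : nat.

Definition affine_perms : {set {perm 'I_n.+2}} :=
  [set s : {perm 'I_n.+2} | [exists a, exists b, forall x, s x == a * x + b]]%SET.

Lemma affine_permsP (s : {perm 'I_n.+2}) :
  reflect (exists a b, forall x, s x = a * x + b) (s \in affine_perms).
Proof.
rewrite inE; apply: (iffP existsP) => -[a].
  by move=> /existsP[b /forallP sE]; exists a, b => x; apply/eqP.
by move=> [b sE]; exists a; apply/existsP; exists b; apply/forallP => x; apply/eqP.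
Qed.

Lemma affine_group_set : group_set affine_perms.
Proof.
apply/group_setP; split.
  by apply/affine_permsP; exists 1, 0 => x; rewrite perm1 mul1r addr0.
move=> s t /affine_permsP[a [b sE]] /affine_permsP[a' [b' tE]].
apply/affine_permsP; exists (a' * a), (a' * b + b') => x.
by rewrite permM tE sE; ring.
Qed.
Canonical affine_group := Group affine_group_set.

Lemma solvable_affine_group : solvable affine_group.
Proof. by apply: (solvable_affine (lab := id)) => // s /affine_permsP. Qed.

End AffineGroup.

(** * Exact integer computation on the vertices *)

Section Dodecahedron.

Definition shift3 (k : 'I_3) : 'S_3 := perm (addIr k).

(** The cube of a shift is the identity, and a sign equals its own cube. *)
Lemma shift3_even k : ~~ odd_perm (shift3 k).
Proof.
have : odd_perm (shift3 k * (shift3 k * shift3 k))%g = false.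
  rewrite -(odd_perm1 'I_3); congr odd_perm; apply/permP => i.
  by rewrite !permM !permE; apply: val_inj; case: k i => [[|[|[|k]]] Hk] [[|[|[|i]]] Hi].
by rewrite !odd_permM addbA addbb => /= ->.
Qed.

Lemma Alt3E : ('Alt_('I_3))%g = [set shift3 k | k : 'I_3]%SET.
Proof.
apply/esym/eqP; rewrite eqEcard; apply/andP; split.
  by apply/fintype.subsetP => _ /imsetP[k _ ->]; rewrite Alt_even shift3_even.
rewrite card_imset ?card_ord; last first.
  by move=> j k /permP/(_ 0); rewrite !permE !add0r.
by rewrite -(leq_pmul2l (isT : 0 < 2)%N) card_Alt card_ord.
Qed.

(* The pair (a, b) stands for a + b * golden. *)
Definition gold_word := seq (int * int).
Definition gscale (s : int) (z : int * int) : int * int := (s * z.1, s * z.2).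
Definition gadd (y z : int * int) : int * int := (y.1 + z.1, y.2 + z.2).
Definition ghalf (z : int * int) : int * int := ((z.1 %/ 2)%Z, (z.2 %/ 2)%Z).
Definition gmulphi (z : int * int) : int * int := (z.2, z.1 + z.2).
(** The inverse of [golden] is [golden - 1], whence (a + b golden) / golden = (b - a) + a golden. *)
Definition gdivphi (z : int * int) : int * int := (z.2 - z.1, z.1).
Definition gopp (z : int * int) : int * int := (- z.1, - z.2).

Definition rot5_double (w : gold_word) : gold_word :=
  if w is [:: x; y; z] then
    [:: gadd x (gadd (gmulphi y) (gdivphi z));
        gadd (gmulphi x) (gopp (gadd (gdivphi y) z));
        gadd y (gopp (gadd (gdivphi x) (gmulphi z)))]
  else [::].
Definition rot5_word (w : gold_word) : gold_word := [seq ghalf z | z <- rot5_double w].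

Definition sign3 : seq (seq int) := [seq s <- sign_words 3 | 0 \notin s].
Definition orbit_words (v : gold_word) : seq gold_word :=
  [seq [seq gscale p.1 p.2 | p <- zip s (seq.rot k v)] | k <- iota 0 3, s <- sign3].
Definition cube_word : gold_word := [:: (1, 0); (1, 0); (1, 0)].
Definition rest_word : gold_word := [:: (0, 0); (-1, 1); (0, 1)].
(** The reference pattern for rotation orbits: the two cube vertices come first. *)
Definition base_word (k : nat) := if (k < 2)%N then cube_word else rest_word.
Definition dodeca_words := orbit_words cube_word ++ orbit_words rest_word.

(** The second conjunct certifies that the floor division in [ghalf] is exact on these words. *)
Lemma rot5_word_stable :
  all (fun w => (rot5_word w \in dodeca_words) &&
                ([seq gscale 2 z | z <- rot5_word w] == rot5_double w)) dodeca_words.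
Proof. by vm_compute. Qed.

(* Along an orbit of the rotation exactly two of the five vertices lie on the cube, and
   AGL(1,5) moves any two positions to the first two. *)
Lemma rot5_pattern :
  all (fun w => has (fun a => has (fun b =>
    all (fun k => iter k rot5_word w \in orbit_words (base_word ((a.1 * k + b) %% 5)%N))
        (iota 0 5)) (iota 0 5)) [:: (1, 1); (2, 3); (3, 2); (4, 4)]%N) dodeca_words.
Proof. by vm_compute. Qed.
End Dodecahedron.

(** * From integer words to real vectors *)

Section DodecahedronEmbedding.
Variable R : realType.
Local Notation phi := (golden R).

Lemma golden_sqr : phi ^+ 2 = phi + 1.
Proof.
have s5 : Num.sqrt 5 ^+ 2 = 5 :> R by rewrite sqr_sqrtr.
by rewrite /golden; move: (Num.sqrt 5) s5 => s s5; field: s5.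
Qed.

Lemma golden_inv : phi^-1 = phi - 1.
Proof.
have p0 : phi != 0.
  by apply/eqP => p0; have /eqP := golden_sqr; rewrite p0 expr0n add0r eq_sym oner_eq0.
apply: (mulfI p0); rewrite mulfV // mulrBr -expr2 golden_sqr; ring.
Qed.

Definition gold_val (z : int * int) : R := z.1%:~R + z.2%:~R * phi.
Definition gold_vec (w : gold_word) : 'rV[R]_3 := coords 3 [seq gold_val z | z <- w].

(* The rotation of order 5 about the axis (phi, 1, 0). *)
Definition rot5 (x : 'rV[R]_3) : 'rV[R]_3 :=
  coords 3 [:: (x 0 0 + phi * x 0 1 + (phi - 1) * x 0 2) / 2;
               (phi * x 0 0 - (phi - 1) * x 0 1 - x 0 2) / 2;
               (x 0 1 - (phi - 1) * x 0 0 - phi * x 0 2) / 2].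

Lemma sum3 (F : 'I_3 -> R) : \sum_i F i = F 0 + F 1 + F 2.
Proof.
rewrite !big_ord_recl big_ord0 addr0 addrA.
by congr (F _ + F _ + F _); apply: val_inj.
Qed.

Lemma sqdist_rot5 x y : sqdist (rot5 x) (rot5 y) = sqdist x y.
Proof.
rewrite /sqdist !sum3 !coordsE /=; by move: phi golden_sqr => p pE; field: pE.
Qed.

Lemma sqdist_iter_rot5 k x y : sqdist (iter k rot5 x) (iter k rot5 y) = sqdist x y.
Proof. by elim: k => //= k; rewrite sqdist_rot5. Qed.

Lemma gold_vec_rot5 w : w \in dodeca_words -> gold_vec (rot5_word w) = rot5 (gold_vec w).
Proof.
move=> Dw; have /andP[/(allP (isT : all (fun w => size w == 3%N) dodeca_words)) sw'] :=
  allP rot5_word_stable w Dw.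
have := allP (isT : all (fun w => size w == 3%N) dodeca_words) w Dw; move: sw'.
rewrite /rot5 /gold_vec; case: w {Dw} => [|x [|y [|z []]]] // _ _ /eqP.
move: (rot5_word _) => [|x' [|y' [|z' []]]] //= -[Ex1 Ex2 Ey1 Ey2 Ez1 Ez2].
have half (t t' : R) : 2 * t = t' -> t = t' / 2 by move=> <-; field.
have double (a : int * int) : 2 * (a.1%:~R + a.2%:~R * phi) =
    (2 * a.1)%:~R + (2 * a.2)%:~R * phi by rewrite !intrM mulrDr mulrA.
move: golden_sqr => pE; apply/rowP => -[[|[|[|i]]] Hi] //; rewrite !coordsE /=; apply: half;
  rewrite /gold_val double (Ex1, Ey1, Ez1) (Ex2, Ey2, Ez2) !(intrD, intrB);
  by move: phi pE => p pE; ring: pE.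
Qed.

(** Even permutations of three coordinates are cyclic shifts, so a finite list of words describes
    the orbit. *)
Lemma signed_permsAltP v x : size v = 3%N ->
  x \in signed_perms (even_perms 3) (gold_vec v) <->
  exists2 w, w \in orbit_words v & x = gold_vec w.
Proof.
move=> sv; have entry s k (i : 'I_3) : size s = 3%N ->
    gold_vec [seq gscale p.1 p.2 | p <- zip s (seq.rot k v)] 0 i =
    (s`_i)%:~R * gold_val (nth (0, 0) (seq.rot k v) i).
  move=> ss; rewrite coordsE -map_comp (nth_map (0, (0, 0))); last first.
    by rewrite size_zip size_rot ss sv.
  by rewrite nth_zip ?size_rot ?ss ?sv //= /gold_val /= !intrM; ring.
have rotE (k i : 'I_3) : nth (0, 0) (seq.rot k v) i = nth (0, 0) v (i + k : 'I_3)%R.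
  by case: v sv {entry} => [|? [|? [|? []]]] //; case: k i => [[|[|[|k]]] Hk] [[|[|[|i]]] Hi].
rewrite even_permsE Alt3E; split.
  move=> /imfset2P[E _ [_ /imsetP[k _ ->] ->]].
  pose s := [seq (-1) ^+ (i \in E) : int | i <- enum 'I_3].
  have ss : size s = 3%N by rewrite size_map size_enum_ord.
  exists [seq gscale p.1 p.2 | p <- zip s (seq.rot k v)].
    apply: (@allpairs_f _ _ _ (fun k s => [seq gscale p.1 p.2 | p <- zip s (seq.rot k v)])).
      by rewrite mem_iota ltn_ord.
    rewrite mem_filter; apply/andP; split.
      by apply/mapP => -[i _ /eqP]; rewrite eq_sym signr_eq0.
    by apply: sign_wordsP => //; apply/allP => _ /mapP[i _ ->]; case: (i \in E).
  apply/rowP => i; rewrite entry // !mxE rotE permE; congr (_ * _).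
    by rewrite (nth_map i) ?size_enum_ord // nth_ord_enum rmorphXn rmorphN1.
  by rewrite (nth_map (0, 0)) // sv.
move=> [w /allpairsP[[k s] /= [k03 sgn_s ->]] ->].
have k3 : (k < 3)%N by move: k03; rewrite !inE => /or3P[]/eqP->.
have : all (fun s => (size s == 3%N) && all (fun x => (x == 1) || (x == -1)) s) sign3.
  by vm_compute.
move=> /allP/(_ s sgn_s)/andP[/eqP ss /allP s1].
apply/imfset2P; exists [set i : 'I_3 | s`_i == -1]%SET; first by rewrite inE.
exists (shift3 (Ordinal k3)); first by apply: imset_f.
apply/rowP => i; rewrite (entry s k) // !mxE -[k]/(nat_of_ord (Ordinal k3)) rotE permE.
rewrite (nth_map (0, 0)) ?sv // inE; congr (_ * _).
have is_ : (i < size s)%N by rewrite ss.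
by case/orP: (s1 _ (mem_nth 0 is_)) => /eqP->; rewrite ?rmorphN1.
Qed.

Lemma gold_vec_cube : gold_vec cube_word = coords 3 [:: 1; 1; 1].
Proof. by rewrite /gold_vec /= /gold_val /= mul0r addr0. Qed.

Lemma gold_vec_rest : gold_vec rest_word = coords 3 [:: 0; phi^-1; phi].
Proof. by rewrite /gold_vec /= /gold_val /= golden_inv !mul0r !add0r mul1r rmorphN1 addrC. Qed.

Lemma dodecahedron_words x :
  x \in dodecahedron R -> exists2 w, w \in dodeca_words & x = gold_vec w.
Proof.
rewrite in_fsetU -gold_vec_cube -gold_vec_rest => /orP[xc|]; last first.
  move=> /(@signed_permsAltP rest_word _ erefl)[w Dw ->].
  by exists w; rewrite // mem_cat Dw orbT.
(* The cube is defined with all permutations; its base vector is constant, so the identity can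
   replace any of them. *)
have : x \in signed_perms (even_perms 3) (gold_vec cube_word).
  move: xc => /imfset2P[E EE [s _ ->]]; apply/imfset2P; exists E => //.
  exists 1%g; first by rewrite inE odd_perm1.
  have ones (i : 'I_3) : (coords 3 [:: 1; 1; 1] : 'rV[R]_3) 0 i = 1.
    by rewrite coordsE; case: i => [[|[|[|i]]] Hi].
  by apply/rowP => i; rewrite gold_vec_cube [LHS]mxE [RHS]mxE !ones.
by move=> /(@signed_permsAltP cube_word _ erefl)[w Dw ->]; exists w; rewrite // mem_cat Dw.
Qed.

Definition base_vec (k : nat) : 'rV[R]_3 := gold_vec (base_word k).

(** Up to an affine reindexing every rotation orbit follows the reference pattern, which places all
    these sequences in one orbit of the wreath product. *)
Lemma dodecahedron_pattern x : x \in dodecahedron R ->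
  exists2 s, s \in affine_group 3 & forall k : 'I_5,
    iter k rot5 x \in signed_perms (even_perms 3) (base_vec (s k)).
Proof.
move=> /dodecahedron_words[w Dw ->].
have Dk k : iter k rot5_word w \in dodeca_words /\
    iter k rot5 (gold_vec w) = gold_vec (iter k rot5_word w).
  elim: k => [//|k [Dk Ek]] /=; rewrite Ek gold_vec_rot5 //; split=> //.
  by have /andP[] := allP rot5_word_stable _ Dk.
have /hasP[[a a'] aa /hasP[b _ /allP pat]] := allP rot5_pattern w Dw.
(* The pairs listed in [rot5_pattern] consist of a unit modulo 5 and its inverse. *)
have aK : cancel (fun x : 'I_5 => inZp a * x + inZp b) (fun x => inZp a' * (x - inZp b)).
  move=> i; rewrite addrK mulrA; have -> : inZp a' * inZp a = 1 :> 'I_5.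
    by apply: val_inj; move: aa; rewrite !inE => /or4P[]/eqP[-> ->].
  by rewrite mul1r.
exists (perm (can_inj aK)).
  by apply/affine_permsP; exists (inZp a), (inZp b) => i; rewrite permE.
move=> k; have [_ ->] := Dk k; apply/signed_permsAltP; first by rewrite /base_word; case: ifP.
exists (iter k rot5_word w) => //; have := pat k; rewrite mem_iota ltn_ord => /(_ isT).
by rewrite permE /= modnMml modnDm.
Qed.

End DodecahedronEmbedding.

(** * Embedding into a wreath product orbit in R^15 *)

Section DodecahedronSubsoluble.
Variable R : realType.

Lemma sqdist_mxvec m n (A B : 'M[R]_(m, n)) :
  sqdist (mxvec A) (mxvec B) = \sum_i sqdist (row i A) (row i B).
Proof.
rewrite /sqdist (reindex _ (curry_mxvec_bij m n)) pair_bigA.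
by apply: eq_bigr => -[i j] _ /=; rewrite !mxvecE !mxE.
Qed.

Lemma sqdistZ d (a : R) (x y : 'rV[R]_d) : sqdist (a *: x) (a *: y) = a ^+ 2 * sqdist x y.
Proof.
by rewrite /sqdist mulr_sumr; apply: eq_bigr => i _; rewrite !mxE -mulrBr exprMn.
Qed.

Lemma subsoluble_dodecahedron (X : {fset 'rV[R]_3}) :
  similar_copy (dodecahedron R) X -> subsoluble X.
Proof.
move=> [c c0 [f [fE XE]]].
pose T := wreath 'S_2 ('Alt_('I_3))%G; pose G := wreath T (affine_group 3).
(* Each of the five rows contributes the squared distance on the standard dodecahedron, and [f]
   scales that by [c ^+ 2]; hence 5 b^2 must equal c^2. *)
pose b := c / Num.sqrt 5.
have b2 : b ^+ 2 = c ^+ 2 / 5 by rewrite expr_div_n sqr_sqrtr.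
pose q (g : G) : 'M[R]_(5, 3) :=
  \matrix_(k, j) signed_act (g.1 k) (base_vec R (sgval g.2 k)) 0 j.
have qM g h k : row k (q (g * h)%g) = signed_act (g.1 k) (row (sgval g.2 k) (q h)).
  apply/rowP => j; rewrite [LHS]mxE [LHS]mxE ffunE permM signed_actM.
  by congr (signed_act _ _ 0 j); apply/rowP => i; rewrite !mxE.
pose p g := b *: mxvec (q g).
pose Y := [fset p g | g in [set: G]%SET]%fset.
have invP x : x \in X -> exists2 v, v \in dodecahedron R & x = f v.
  by rewrite XE => /imfsetP[v /= Dv ->]; exists v.
(* A total section of [f], with the default value 0 outside [X]. *)
have /choice[inv invS] x : exists v, x \in X -> v \in dodecahedron R /\ x = f v.
  have [/invP[v Dv xv]|] := boolP (x \in X); first by exists v.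
  by exists 0.
pose emb x := b *: mxvec (\matrix_(k < 5, j < 3) iter k (@rot5 R) (inv x) 0 j).
have embE x y : x \in X -> y \in X -> sqdist (emb x) (emb y) = sqdist x y.
  move=> /invS[Dx xE] /invS[Dy yE]; rewrite sqdistZ sqdist_mxvec.
  have rowE v (k : 'I_5) :
      row k (\matrix_(k < 5, j < 3) iter k (@rot5 R) v 0 j) = iter k (@rot5 R) v.
    by apply/rowP => j; rewrite !mxE.
  under eq_bigr do rewrite !rowE sqdist_iter_rot5.
  rewrite sumr_const card_ord b2 [in RHS]xE [in RHS]yE.
  have -> : sqdist (f (inv x)) (f (inv y)) = c ^+ 2 * sqdist (inv x) (inv y).
    by apply/eucl_dist_scale; [exact: ltW|exact: fE].
  by rewrite -mulr_natr; field.
exists (5 * 3)%N, Y; split.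
  apply: (@soluble_set_orbit _ _ G p).
  - apply: soluble_wreath (solvable_affine_group 3).
    apply: soluble_wreath; last by apply: solvable_small_degree; rewrite card_ord.
    by apply: soluble_group_abelian; exact: S2_comm.
  - move=> g h k; rewrite !sqdistZ !sqdist_mxvec; congr (_ * _).
    rewrite [RHS](reindex_inj (@perm_inj _ (sgval g.2))).
    by apply: eq_bigr => i _; rewrite !qM sqdist_signed_act.
  - move=> x; split=> [/imfsetP[g _ ->]|[g ->]];
      by [exists g|apply/imfsetP; exists g; rewrite ?inE].
exists [fset emb x | x in X]%fset.
  by exists emb; split=> // x y Xx Xy; rewrite mul1r; apply/eucl_dist_eq/embE.
apply/fsubsetP => _ /imfsetP[x /= /invS[Dx _] ->].
have [s Hs sE] := dodecahedron_pattern Dx.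
have /choice[t tE] (k : 'I_5) :
    exists t : T, iter k (@rot5 R) (inv x) = signed_act t (base_vec R (s k)).
  by move: (sE k); rewrite even_permsE => /(@signed_permsP _ _ ('Alt_('I_3))%G).
apply/imfsetP; exists ([ffun k => t k], subg (affine_group 3) s); first by rewrite inE.
rewrite /p /emb; congr (_ *: mxvec _); apply/matrixP => k j.
rewrite [LHS]mxE [RHS]mxE ffunE subgK //. by rewrite tE.
Qed.

End DodecahedronSubsoluble.

Theorem theorem4p1 (R : realType) :
  (forall (d : nat) (X : {fset 'rV[R]_d}), regular_polytope X ->
     ~ similar_copy (cell120 R) X -> ~ similar_copy (cell600 R) X -> subsoluble X)
  /\
  (* (a) *)
  [/\ forall (n : nat) (X : {fset 'rV[R]_2}), (3 <= n)%N ->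
        similar_copy (polygon R n) X -> soluble_group (symmetry_group X),
      forall X : {fset 'rV[R]_3},
        regular_simplex X \/ similar_copy (hypercube R 3) X \/ similar_copy (orthoplex R 3) X ->
        soluble_group (symmetry_group X)
    & forall X : {fset 'rV[R]_4},
        similar_copy (hypercube R 4) X \/ similar_copy (orthoplex R 4) X \/
        similar_copy (cell24 R) X ->
        soluble_group (symmetry_group X)]
  /\
  (* (b) *)
  [/\ forall X : {fset 'rV[R]_3}, similar_copy (icosahedron R) X -> soluble_set X,
      forall X : {fset 'rV[R]_4}, regular_simplex X -> soluble_set X
    & forall (d : nat) (X : {fset 'rV[R]_d}), (5 <= d)%N ->
        regular_simplex X \/ similar_copy (hypercube R d) X \/ similar_copy (orthoplex R d) X ->
        soluble_set X]
  /\
  (* (c) *)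
  (forall X : {fset 'rV[R]_3}, similar_copy (dodecahedron R) X ->
     exists (n : nat) (Y : {fset 'rV[R]_n}), soluble_set Y /\
       exists2 X' : {fset 'rV[R]_n}, isometric_copy X X' & (X' `<=` Y)%fset).
Proof.
have polytope_sym d (V X : {fset 'rV[R]_d}) : soluble_set V -> frame V ->
    similar_copy V X -> solvable (isom_group X) -> soluble_group (symmetry_group X).
  move=> solV frV VX; apply: soluble_symmetry_group; first exact: soluble_set_similar VX.
  exact: frame_scaled frV.
have solc d (X : {fset 'rV[R]_d}) : similar_copy (hypercube R d) X -> soluble_set X.
  exact: soluble_set_similar (@soluble_set_hypercube R d).
have solo d (X : {fset 'rV[R]_d}) : (0 < d)%N -> similar_copy (orthoplex R d) X -> soluble_set X.
  by move=> d0; exact: soluble_set_similar (@soluble_set_orthoplex R d d0).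
split; [|split; [split|split; [split|]]].
- move=> d X; case=> {d X}.
  + move=> n X n3 VX _ _; apply: soluble_subsoluble.
    by apply: soluble_set_similar VX; apply: soluble_set_polygon; exact: ltn_trans n3.
  + by move=> d X _ /soluble_set_simplex/soluble_subsoluble.
  + by move=> d X _ /solc/soluble_subsoluble.
  + by move=> d X d3 /solo sX _ _; apply: soluble_subsoluble; apply: sX; exact: ltn_trans d3.
  + by move=> X /subsoluble_dodecahedron.
  + move=> X VX _ _; apply: soluble_subsoluble.
    exact: soluble_set_similar (@soluble_set_icosahedron R) VX.
  + move=> X VX _ _; apply: soluble_subsoluble.
    exact: soluble_set_similar (@soluble_set_cell24 R) VX.
  + by move=> X VX /(_ VX).
  + by move=> X VX _ /(_ VX).
- move=> n X n3 VX; apply: (polytope_sym _ _ _ _ _ VX).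
  + by apply: soluble_set_polygon; exact: ltn_trans n3.
  + exact: frame_polygon.
  + exact: solvable_isom_polygon VX.
- move=> X [simX|[VX|VX]].
  + apply: soluble_symmetry_group; first exact: soluble_set_simplex.
      exact: frame_simplex.
    exact: solvable_isom_simplex3.
  + apply: (polytope_sym _ _ _ _ _ VX); [exact: soluble_set_hypercube|exact: frame_hypercube|].
    (* With coordinates 1 and -1, squared distance 12 joins antipodes: four pairs. *)
    by apply: (solvable_isom_hypercube (Vs := [:: [:: 0; 12]]) VX); vm_compute.
  + apply: (polytope_sym _ _ _ _ _ VX); [exact: soluble_set_orthoplex|exact: frame_orthoplex|].
    (* Squared distance 4 joins antipodes: three pairs here, four in dimension 4. *)
    by apply: (solvable_isom_orthoplex (Vs := [:: [:: 0; 4]]) VX); vm_compute.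
- move=> X [VX|[VX|VX]].
  + apply: (polytope_sym _ _ _ _ _ VX); [exact: soluble_set_hypercube|exact: frame_hypercube|].
    (* Even Hamming distance (squared distances 0, 8, 16) gives two half-cubes, each made of four
       antipodal pairs at squared distance 16. *)
    by apply: (solvable_isom_hypercube (Vs := [:: [:: 0; 8; 16]; [:: 0; 16]]) VX); vm_compute.
  + apply: (polytope_sym _ _ _ _ _ VX); [exact: soluble_set_orthoplex|exact: frame_orthoplex|].
    by apply: (solvable_isom_orthoplex (Vs := [:: [:: 0; 4]]) VX); vm_compute.
  + apply: (polytope_sym _ _ _ _ _ VX); [exact: soluble_set_cell24|exact: frame_cell24|].
    exact: solvable_isom_cell24.
- by move=> X; exact: soluble_set_similar (@soluble_set_icosahedron R).
- by move=> X; exact: soluble_set_simplex.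
- move=> d X d5 [/soluble_set_simplex//|[/solc//|]].
  by apply: solo; exact: ltn_trans d5.
- exact: subsoluble_dodecahedron.
Qed.
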